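(* Let $(S,\mathfrak n)$ be a commutative noetherian local ring and let $\omega\in\mathfrak n$ be a non-zerodivisor. Then: (1) The inclusion functor $i:\mathsf{Mon}(\omega,\mathcal P)\to\mathsf{Mon}(\omega,\mathcal G)$ induces a fully faithful triangle functor $\underline{i}:\underline{\mathsf{Mon}}(\omega,\mathcal P)\to\underline{\mathsf{Mon}}(\omega,\mathcal G)$ between the stable categories. (2) There is a triangle equivalence functor $F:\underline{\mathsf{Mon}}(\omega,\mathcal P)\to\mathsf{DB}(\omega)$.
   Context: All modules are finitely generated. $\mathcal P(S)$ (resp. $\mathcal G(S)$) denotes the category of finitely generated projective (resp. Gorenstein projective) $S$-modules. $\mathsf{Mor}(S)$ is the abelian category whose objects are $S$-homomorphisms $(M\xrightarrow{f}N)$ of finitely generated $S$-modules, a morphism $(M\xrightarrow{f}N)\to(M'\xrightarrow{f'}N')$ being a pair $(\psi_1,\psi_0)$ of $S$-homomorphisms $\psi_1:M\to M'$, $\psi_0:N\to N'$ with $\psi_0f=f'\psi_1$. $\mathsf{Mon}(\omega,\mathcal G)$ is the full subcategory of $\mathsf{Mor}(S)$ whose objects are the monomorphisms $(G\xrightarrow{f}P)$ with $G\in\mathcal G(S)$, $P\in\mathcal P(S)$ and $\omega\cdot\operatorname{Coker}f=0$; $\mathsf{Mon}(\omega,\mathcal P)$ is the full subcategory of those objects $(P\xrightarrow{f}Q)$ with $P,Q\in\mathcal P(S)$. Each of these two categories is an exact category in the sense of Quillen, with conflations the short exact sequences of $\mathsf{Mor}(S)$ (i.e. componentwise exact) all of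 whose terms lie in the category, and each is Frobenius (enough projectives, enough injectives, and projectives coincide with injectives). The stable category $\underline{\mathcal A}$ of a Frobenius category $\mathcal A$ has the same objects, with morphisms taken modulo those factoring through projective objects; it carries its standard (Happel) triangulated structure, whose shift is the inverse of the syzygy functor. $\mathsf{Pair}(\omega)$ is the category whose objects are pairs $(\rho_1:P_1\to P_0,\ \rho_0:P_0\to P_1)$ with $P_1,P_0$ projective $S$-modules and $\rho_0\rho_1=\omega\cdot\mathrm{id}_{P_1}$, $\rho_1\rho_0=\omega\cdot\mathrm{id}_{P_0}$; a morphism $(\rho_1,\rho_0)\to(q_1,q_0)$, with $(q_1:Q_1\to Q_0,\ q_0:Q_0\to Q_1)$, is a pair $\psi_1:P_1\to Q_1$, $\psi_0:P_0\to Q_0$ with $\psi_1\rho_0=q_0\psi_0$ and $q_1\psi_1=\psi_0\rho_1$. Such a morphism is null-homotopic if there are $S$-homomorphisms $s_0:P_0\to Q_1$, $s_1:P_1\to Q_0$ with $\psi_0=q_1s_0+s_1\rho_0$ and $\psi_1=s_0\rho_1+q_0s_1$. $\mathsf{DB}(\omega)$ (the category of D-branes of type B, i.e. the homotopy category of matrix factorizations) has the same objects as $\mathsf{Pair}(\omega)$ and morphisms those of $\mathsf{Pair}(\omega)$ modulo null-homotopic ones. It is triangulated: the shift of $(\rho_1:P_1\to P_0,\rho_0:P_0\to P_1)$ is $(-\rho_0:P_0\to P_1,-\rho_1:P_1\to P_0)$, and the exact triangles are those isomorphic to standard triangles given by mapping cones, the cone of $(\psi_1,\psi_0)$ being given by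 $\begin{pmatrix}q_1&\psi_0\\0&-\rho_0\end{pmatrix}:Q_1\oplus P_0\to Q_0\oplus P_1$ and $\begin{pmatrix}q_0&\psi_1\\0&-\rho_1\end{pmatrix}:Q_0\oplus P_1\to Q_1\oplus P_0$. *)

(* Defs.v *)
From HB Require Import structures.
From mathcomp Require Import all_boot all_order all_algebra.
From mathcomp Require Import boolp.
From Stdlib Require Import Setoid Morphisms RelationClasses.

Set Implicit Arguments.
Unset Strict Implicit.
Unset Printing Implicit Defensive.

Import GRing.Theory.
Local Open Scope ring_scope.

(* Preadditive categories whose Hom-sets are setoids: [heq] is equality of
   morphisms.  Passing to a quotient category coarsens [heq] and keeps the
   objects and the representatives of the morphisms. *)
Record precat := Precat {
  obj :> Type;
  arrow : obj -> obj -> Type;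
  heq : forall X Y, arrow X Y -> arrow X Y -> Prop;
  idm : forall X, arrow X X;
  ccomp : forall X Y Z, arrow Y Z -> arrow X Y -> arrow X Z;
  hzero : forall X Y, arrow X Y;
  hadd : forall X Y, arrow X Y -> arrow X Y -> arrow X Y;
  hopp : forall X Y, arrow X Y -> arrow X Y;
  heq_equiv : forall X Y, Equivalence (@heq X Y);
  ccomp_heq : forall X Y Z (g g' : arrow Y Z) (f f' : arrow X Y),
    heq g g' -> heq f f' -> heq (ccomp g f) (ccomp g' f');
  hadd_heq : forall X Y (f f' g g' : arrow X Y),
    heq f f' -> heq g g' -> heq (hadd f g) (hadd f' g');
  hopp_heq : forall X Y (f f' : arrow X Y), heq f f' -> heq (hopp f) (hopp f');
  ccompA : forall X Y Z W (h : arrow Z W) (g : arrow Y Z) (f : arrow X Y),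
    heq (ccomp h (ccomp g f)) (ccomp (ccomp h g) f);
  ccomp1m : forall X Y (f : arrow X Y), heq (ccomp (idm Y) f) f;
  ccompm1 : forall X Y (f : arrow X Y), heq (ccomp f (idm X)) f;
  haddA : forall X Y (f g h : arrow X Y),
    heq (hadd f (hadd g h)) (hadd (hadd f g) h);
  haddC : forall X Y (f g : arrow X Y), heq (hadd f g) (hadd g f);
  hadd0 : forall X Y (f : arrow X Y), heq (hadd (hzero X Y) f) f;
  haddN : forall X Y (f : arrow X Y), heq (hadd (hopp f) f) (hzero X Y);
  ccompDl : forall X Y Z (g g' : arrow Y Z) (f : arrow X Y),
    heq (ccomp (hadd g g') f) (hadd (ccomp g f) (ccomp g' f));
  ccompDr : forall X Y Z (g : arrow Y Z) (f f' : arrow X Y),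
    heq (ccomp g (hadd f f')) (hadd (ccomp g f) (ccomp g f'))
}.

Arguments arrow {_} _ _.
Arguments heq {_ _ _} _ _.
Arguments idm {_} _.
Arguments ccomp {_ _ _ _} _ _.
Arguments hzero {_} _ _.
Arguments hadd {_ _ _} _ _.
Arguments hopp {_ _ _} _.

Declare Scope cat_scope.
Delimit Scope cat_scope with cat.
Bind Scope cat_scope with arrow.
Notation "f ≈ g" := (heq f g) (at level 70, no associativity) : cat_scope.
Notation "g ∘ f" := (ccomp g f) (at level 40, left associativity) : cat_scope.
Notation "f ⊕ g" := (hadd f g) (at level 50, left associativity) : cat_scope.
Notation "f ⊖ g" := (hadd f (hopp g)) (at level 50, left associativity) :
  cat_scope.

#[global] Existing Instance heq_equiv.
#[global] Instance ccomp_Proper (C : precat) (X Y Z : C) :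
  Proper (heq ==> heq ==> heq) (@ccomp C X Y Z).
Proof. by move=> g g' gg' f f' ff'; apply: ccomp_heq. Qed.
#[global] Instance hadd_Proper (C : precat) (X Y : C) :
  Proper (heq ==> heq ==> heq) (@hadd C X Y).
Proof. by move=> g g' gg' f f' ff'; apply: hadd_heq. Qed.
#[global] Instance hopp_Proper (C : precat) (X Y : C) :
  Proper (heq ==> heq) (@hopp C X Y).
Proof. by move=> f f'; apply: hopp_heq. Qed.

Section PrecatTheory.
Local Open Scope cat_scope.
Variable C : precat.
Implicit Types X Y Z : C.

Lemma hrefl X Y (f : arrow X Y) : f ≈ f. Proof. reflexivity. Qed.
Lemma hsym X Y (f g : arrow X Y) : f ≈ g -> g ≈ f. Proof. by move=> ?; symmetry. Qed.
Lemma htrans X Y (g f h : arrow X Y) : f ≈ g -> g ≈ h -> f ≈ h.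
Proof. by move=> H K; transitivity g. Qed.

Lemma hadd0r X Y (f : arrow X Y) : f ⊕ hzero X Y ≈ f.
Proof. by rewrite haddC hadd0; reflexivity. Qed.
Lemma haddNr X Y (f : arrow X Y) : f ⊖ f ≈ hzero X Y.
Proof. by rewrite haddC haddN; reflexivity. Qed.
Lemma haddACA X Y (a b c d : arrow X Y) :
  (a ⊕ b) ⊕ (c ⊕ d) ≈ (a ⊕ c) ⊕ (b ⊕ d).
Proof.
rewrite -!haddA; apply: hadd_heq; first exact: hrefl.
by rewrite !haddA (haddC b c); exact: hrefl.
Qed.
Lemma hopp_uniq X Y (f g : arrow X Y) : g ⊕ f ≈ hzero X Y -> g ≈ hopp f.
Proof.
move=> H; rewrite -(hadd0r g) -(haddNr f) haddA H hadd0; exact: hrefl.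
Qed.
Lemma hoppK X Y (f : arrow X Y) : hopp (hopp f) ≈ f.
Proof. by apply: hsym; apply: hopp_uniq; rewrite haddNr; exact: hrefl. Qed.
Lemma hoppD X Y (f g : arrow X Y) : hopp (f ⊕ g) ≈ hopp f ⊕ hopp g.
Proof.
apply: hsym; apply: hopp_uniq.
rewrite haddACA !haddN hadd0; exact: hrefl.
Qed.
Lemma hopp0 X Y : hopp (hzero X Y) ≈ hzero X Y.
Proof. by apply: hsym; apply: hopp_uniq; rewrite hadd0; exact: hrefl. Qed.
Lemma hadd_idem0 X Y (f : arrow X Y) : f ⊕ f ≈ f -> f ≈ hzero X Y.
Proof.
by move=> H; rewrite -(hadd0 f) -(haddN f) -haddA H; exact: hrefl.
Qed.
Lemma ccompm0 X Y Z (g : arrow Y Z) : g ∘ hzero X Y ≈ hzero X Z.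
Proof. by apply: hadd_idem0; rewrite -ccompDr hadd0; exact: hrefl. Qed.
Lemma ccomp0m X Y Z (f : arrow X Y) : hzero Y Z ∘ f ≈ hzero X Z.
Proof. by apply: hadd_idem0; rewrite -ccompDl hadd0; exact: hrefl. Qed.
Lemma ccompmN X Y Z (g : arrow Y Z) (f : arrow X Y) : g ∘ hopp f ≈ hopp (g ∘ f).
Proof. by apply: hopp_uniq; rewrite -ccompDr haddN ccompm0; exact: hrefl. Qed.
Lemma ccompNm X Y Z (g : arrow Y Z) (f : arrow X Y) : hopp g ∘ f ≈ hopp (g ∘ f).
Proof. by apply: hopp_uniq; rewrite -ccompDl haddN ccomp0m; exact: hrefl. Qed.
Lemma hsub_eq0 X Y (f g : arrow X Y) : f ⊖ g ≈ hzero X Y -> f ≈ g.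
Proof.
by move=> /hopp_uniq ->; rewrite hoppK; exact: hrefl.
Qed.
Lemma heq_sub0 X Y (f g : arrow X Y) : f ≈ g -> f ⊖ g ≈ hzero X Y.
Proof. by move=> ->; exact: haddNr. Qed.
Lemma hsubK X Y (f g h : arrow X Y) : (f ⊖ g) ⊕ (g ⊖ h) ≈ f ⊖ h.
Proof. rewrite -haddA (haddA (hopp g)) haddN hadd0; exact: hrefl. Qed.
Lemma hsubDD X Y (f f' g g' : arrow X Y) :
  (f ⊕ g) ⊖ (f' ⊕ g') ≈ (f ⊖ f') ⊕ (g ⊖ g').
Proof. rewrite hoppD haddACA; exact: hrefl. Qed.

End PrecatTheory.

Record ideal (C : precat) := Ideal {
  inI :> forall X Y : C, arrow X Y -> Prop;
  inI_heq : forall (X Y : C) (f g : arrow X Y), heq f g -> inI f -> inI g;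
  inI_add : forall (X Y : C) (f g : arrow X Y), inI f -> inI g -> inI (hadd f g);
  inI_zero : forall X Y : C, inI (hzero X Y);
  inI_comp : forall (X Y Z W : C) (h : arrow Z W) (g : arrow Y Z) (f : arrow X Y),
    inI g -> inI (ccomp h (ccomp g f))
}.

Section Quotient.
Local Open Scope cat_scope.
Variables (C : precat) (N : ideal C).
Definition quot_heq (X Y : C) (f g : arrow X Y) := N _ _ (f ⊖ g).

Lemma inI_compl (X Y Z : C) (h : arrow Y Z) (g : arrow X Y) : N _ _ g -> N _ _ (h ∘ g).
Proof.
move=> H; apply: inI_heq (inI_comp h (idm _) H); rewrite ccompm1; exact: hrefl.
Qed.
Lemma inI_compr (X Y Z : C) (h : arrow Y Z) (g : arrow X Y) : N _ _ h -> N _ _ (h ∘ g).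
Proof. by move=> H; apply: inI_heq (inI_comp (idm _) g H); rewrite ccomp1m; exact: hrefl. Qed.
Lemma inI_opp (X Y : C) (f : arrow X Y) : N _ _ f -> N _ _ (hopp f).
Proof.
move=> H; apply: inI_heq (inI_compl (hopp (idm _)) H).
by rewrite ccompNm ccomp1m; exact: hrefl.
Qed.

Lemma quot_of_heq (X Y : C) (f g : arrow X Y) : f ≈ g -> quot_heq f g.
Proof. by move=> H; apply: inI_heq (inI_zero N X Y); rewrite H haddNr; exact: hrefl. Qed.

Lemma quot_equiv (X Y : C) : Equivalence (@quot_heq X Y).
Proof.
split=> [f|f g H|f g h H K]; first exact/quot_of_heq/hrefl.
  by apply: inI_heq (inI_opp H); rewrite hoppD hoppK haddC; exact: hrefl.
by apply: inI_heq (inI_add H K); exact: hsubK.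
Qed.

Lemma quot_comp (X Y Z : C) (g g' : arrow Y Z) (f f' : arrow X Y) :
  quot_heq g g' -> quot_heq f f' -> quot_heq (g ∘ f) (g' ∘ f').
Proof.
move=> /(inI_compr f) H /(inI_compl g') K; apply: inI_heq (inI_add H K).
by rewrite ccompDl ccompDr ccompNm ccompmN hsubK; exact: hrefl.
Qed.
Lemma quot_add (X Y : C) (f f' g g' : arrow X Y) :
  quot_heq f f' -> quot_heq g g' -> quot_heq (f ⊕ g) (f' ⊕ g').
Proof. by move=> H K; apply: inI_heq (inI_add H K); symmetry; exact: hsubDD. Qed.
Lemma quot_opp (X Y : C) (f f' : arrow X Y) :
  quot_heq f f' -> quot_heq (hopp f) (hopp f').
Proof. by move=> H; apply: inI_heq (inI_opp H); rewrite hoppD; exact: hrefl. Qed.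

Definition quocat : precat.
Proof.
refine (@Precat C (@arrow C) quot_heq (@idm C) (@ccomp C) (@hzero C) (@hadd C)
  (@hopp C) quot_equiv quot_comp quot_add quot_opp _ _ _ _ _ _ _ _ _);
  move=> *; apply: quot_of_heq.
exact: ccompA. exact: ccomp1m. exact: ccompm1. exact: haddA. exact: haddC.
exact: hadd0. exact: haddN. exact: ccompDl. exact: ccompDr.
Defined.
End Quotient.

Record functor (C D : precat) := Functor {
  fobj :> C -> D;
  fmap : forall X Y : C, arrow X Y -> arrow (fobj X) (fobj Y);
  fmap_heq : forall (X Y : C) (f g : arrow X Y),
    heq f g -> heq (fmap f) (fmap g);
  fmap1 : forall X : C, heq (fmap (idm X)) (idm (fobj X));
  fmapM : forall (X Y Z : C) (g : arrow Y Z) (f : arrow X Y),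
    heq (fmap (ccomp g f)) (ccomp (fmap g) (fmap f));
  fmapD : forall (X Y : C) (f g : arrow X Y),
    heq (fmap (hadd f g)) (hadd (fmap f) (fmap g))
}.
Arguments fmap {_ _} _ {_ _} _.

#[global] Instance fmap_Proper (C D : precat) (F : functor C D) (X Y : C) :
  Proper (heq ==> heq) (@fmap C D F X Y).
Proof. by move=> f g; apply: fmap_heq. Qed.

Definition fid (C : precat) : functor C C.
Proof.
by refine (@Functor C C id (fun _ _ => id) _ _ _ _) => // *; exact: hrefl.
Defined.

Definition fcomp (C D E : precat) (G : functor D E) (F : functor C D) :
  functor C E.
Proof.
refine (@Functor C E (fun X => G (F X)) (fun _ _ f => fmap G (fmap F f)) _ _ _ _).
- by move=> X Y f g ->; exact: hrefl.
- by move=> X; rewrite !fmap1; exact: hrefl.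
- by move=> X Y Z g f; rewrite !fmapM; exact: hrefl.
- by move=> X Y f g; rewrite !fmapD; exact: hrefl.
Defined.

Section Functors.
Local Open Scope cat_scope.
Definition is_iso (C : precat) (X Y : C) (f : arrow X Y) :=
  exists g : arrow Y X, g ∘ f ≈ idm X /\ f ∘ g ≈ idm Y.

Definition nat_iso (C D : precat) (F G : functor C D)
    (t : forall X, arrow (F X) (G X)) :=
  (forall X, is_iso (t X)) /\
  (forall (X Y : C) (f : arrow X Y), t Y ∘ fmap F f ≈ fmap G f ∘ t X).

Definition fully_faithful (C D : precat) (F : functor C D) :=
  (forall (X Y : C) (f g : arrow X Y), fmap F f ≈ fmap F g -> f ≈ g) /\
  (forall (X Y : C) (h : arrow (F X) (F Y)), exists f : arrow X Y, fmap F f ≈ h).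

Definition equivalence (C D : precat) (F : functor C D) :=
  exists G : functor D C,
    (exists t, @nat_iso C C (fcomp G F) (fid C) t) /\
    (exists t, @nat_iso D D (fcomp F G) (fid D) t).
End Functors.

(* The data of a triangulated category: a shift functor and a class of
   distinguished triangles [X -> Y -> Z -> shift X].  Being a triangle functor
   only refers to this data, not to the axioms (TR1)-(TR4). *)
Record tricat := Tricat {
  tcat :> precat;
  shift : functor tcat tcat;
  dist : forall X Y Z : tcat, arrow X Y -> arrow Y Z -> arrow Z (shift X) -> Prop
}.
Arguments shift {_}.
Arguments dist {_ _ _ _} _ _ _.

Definition tri_iso (C : precat) (T : functor C C) (X Y Z X' Y' Z' : C)
    (u : arrow X Y) (v : arrow Y Z) (w : arrow Z (T X))
    (u' : arrow X' Y') (v' : arrow Y' Z') (w' : arrow Z' (T X')) :=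
  exists (a : arrow X X') (b : arrow Y Y') (c : arrow Z Z'),
    [/\ is_iso a, is_iso b & is_iso c] /\
    [/\ heq (ccomp b u) (ccomp u' a), heq (ccomp c v) (ccomp v' b)
      & heq (ccomp (fmap T a) w) (ccomp w' c)].

Definition triangle_functor (C D : tricat) (F : functor C D)
    (theta : forall X : C, arrow (F (shift X)) (shift (F X))) :=
  @nat_iso C D (fcomp F shift) (fcomp shift F) theta /\
  (forall (X Y Z : C) (u : arrow X Y) (v : arrow Y Z) (w : arrow Z (shift X)),
    dist u v w -> dist (fmap F u) (fmap F v) (ccomp (theta X) (fmap F w))).

Section Exact.
Local Open Scope cat_scope.

Definition is_kernel (C : precat) (X Y Z : C) (i : arrow X Y) (p : arrow Y Z) :=
  p ∘ i ≈ hzero X Z /\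
  forall (W : C) (t : arrow W Y), p ∘ t ≈ hzero W Z ->
    exists s : arrow W X, i ∘ s ≈ t /\ forall s', i ∘ s' ≈ t -> s' ≈ s.

Definition is_cokernel (C : precat) (X Y Z : C) (i : arrow X Y) (p : arrow Y Z) :=
  p ∘ i ≈ hzero X Z /\
  forall (W : C) (t : arrow Y W), t ∘ i ≈ hzero X W ->
    exists s : arrow Z W, s ∘ p ≈ t /\ forall s', s' ∘ p ≈ t -> s' ≈ s.

(* A category with a class of kernel-cokernel pairs, the conflations. *)
Record excat := Excat {
  ecat :> precat;
  conf : forall X Y Z : ecat, arrow X Y -> arrow Y Z -> Prop;
  conf_kernel : forall (X Y Z : ecat) (i : arrow X Y) (p : arrow Y Z),
    conf i p -> is_kernel i p;
  conf_cokernel : forall (X Y Z : ecat) (i : arrow X Y) (p : arrow Y Z),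
    conf i p -> is_cokernel i p
}.
Arguments conf {_ _ _ _} _ _.

Variable E : excat.
Implicit Types X Y Z P I : E.

Definition projective_obj P :=
  forall X Y Z (i : arrow X Y) (p : arrow Y Z), conf i p ->
  forall t : arrow P Z, exists s : arrow P Y, p ∘ s ≈ t.

Definition injective_obj I :=
  forall X Y Z (i : arrow X Y) (p : arrow Y Z), conf i p ->
  forall t : arrow X I, exists s : arrow Y I, s ∘ i ≈ t.

Definition is_biproduct X Y Z (i : arrow X Z) (j : arrow Y Z)
    (p : arrow Z X) (q : arrow Z Y) :=
  [/\ p ∘ i ≈ idm X, q ∘ j ≈ idm Y, q ∘ i ≈ hzero X Y, p ∘ j ≈ hzero Y X
    & (i ∘ p) ⊕ (j ∘ q) ≈ idm Z].

(* A Frobenius structure, including a choice for every object [X] of a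
   conflation [X -> fr_inj X -> cosyz X] with injective middle term; the shift
   of the stable category depends on this choice up to natural isomorphism. *)
Record frobenius := Frobenius {
  fr_biprod : forall X Y, exists Z i j p q, @is_biproduct X Y Z i j p q;
  fr_inj : E -> E;
  cosyz : E -> E;
  fr_iota : forall X, arrow X (fr_inj X);
  fr_pi : forall X, arrow (fr_inj X) (cosyz X);
  fr_conf : forall X, conf (fr_iota X) (fr_pi X);
  fr_injP : forall X, injective_obj (fr_inj X);
  fr_enough_proj : forall X, exists K P (i : arrow K P) (p : arrow P X),
    conf i p /\ projective_obj P;
  fr_proj_inj : forall X, projective_obj X <-> injective_obj X
}.

Definition thru_proj X Y (f : arrow X Y) :=
  exists P (b : arrow P Y) (a : arrow X P), projective_obj P /\ f ≈ b ∘ a.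

Variable T : frobenius.
Local Notation ι := (fr_iota T).
Local Notation π := (fr_pi T).

Definition thru_proj_ideal : ideal E.
Proof.
refine (@Ideal E thru_proj _ _ _ _).
- by move=> X Y f g fg [P [b [a [pP H]]]]; exists P, b, a; rewrite -fg.
- move=> X Y f g [P [b [a [pP H]]]] [Q [d [c [pQ K]]]].
  have [Z [i [j [p [q [pi qj qi pj ip]]]]]] := fr_biprod T P Q.
  exists Z, ((b ∘ p) ⊕ (d ∘ q)), ((i ∘ a) ⊕ (j ∘ c)); split; last first.
    rewrite H K ccompDr !ccompDl.
    rewrite -!(ccompA _ p) -!(ccompA _ q) !(ccompA p) !(ccompA q) pi qj qi pj.
    by rewrite !ccomp1m !ccomp0m !ccompm0 hadd0 hadd0r; exact: hrefl.
  move=> X' Y' Z' i' p' cf t.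
  have [s Hs] := pP _ _ _ _ _ cf (t ∘ i).
  have [r Hr] := pQ _ _ _ _ _ cf (t ∘ j).
  exists ((s ∘ p) ⊕ (r ∘ q)).
  by rewrite ccompDr !ccompA Hs Hr -!ccompA -ccompDr ip ccompm1; exact: hrefl.
- move=> X Y; exists (fr_inj T X), (hzero _ Y), (ι X).
  split; first by apply/(fr_proj_inj T); exact: fr_injP.
  by rewrite ccomp0m; exact: hrefl.
- move=> X Y Z W h g f [P [b [a [pP H]]]].
  exists P, (h ∘ b), (a ∘ f); split=> //.
  by rewrite H !ccompA; exact: hrefl.
Defined.

(* [g] is the map of cosyzygies induced by [f]. *)
Definition cosyz_rel X Y (f : arrow X Y) (g : arrow (cosyz T X) (cosyz T Y)) :=
  exists h : arrow (fr_inj T X) (fr_inj T Y),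
    h ∘ ι X ≈ ι Y ∘ f /\ g ∘ π X ≈ π Y ∘ h.

Lemma conf_epi X Y Z W (i : arrow X Y) (p : arrow Y Z) (s s' : arrow Z W) :
  conf i p -> s ∘ p ≈ s' ∘ p -> s ≈ s'.
Proof.
move=> /conf_cokernel[pi H] e.
have [|r [_ U]] := H _ (s ∘ p); first by rewrite -ccompA pi ccompm0; exact: hrefl.
by apply: htrans (U s (hrefl _)) (hsym (U s' (hsym e))).
Qed.

Lemma cosyz_ex X Y (f : arrow X Y) : exists g, cosyz_rel f g.
Proof.
have [h Hh] := fr_injP (fr_conf T X) (ι Y ∘ f).
have [_ H] := conf_cokernel (fr_conf T X).
have [|g [Hg _]] := H _ (π Y ∘ h); last by exists g, h.
have [K _] := conf_cokernel (fr_conf T Y).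
by rewrite -ccompA Hh ccompA K ccomp0m; exact: hrefl.
Qed.

Lemma cosyz_rel_uniq X Y (f f' : arrow X Y) g g' :
  thru_proj (f ⊖ f') -> cosyz_rel f g -> cosyz_rel f' g' -> thru_proj (g ⊖ g').
Proof.
move=> [P [b [a [pP H]]]] [h [h1 h2]] [h' [h'1 h'2]].
have iP : injective_obj P by apply/(fr_proj_inj T).
have [a' Ha] := iP _ _ _ _ _ (fr_conf T X) a.
have [piY _] := conf_cokernel (fr_conf T Y).
have [_ U] := conf_cokernel (fr_conf T X).
have [|t [Ht _]] := U _ ((h ⊖ h') ⊖ (ι Y ∘ b ∘ a')).
  rewrite !ccompDl !ccompNm -!ccompA Ha -H h1 h'1 ccompDr ccompmN.
  exact: haddNr.
exists (fr_inj T Y), (π Y), t; split.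
  by apply/(fr_proj_inj T); exact: fr_injP.
apply: conf_epi (fr_conf T X) _.
rewrite -ccompA Ht !ccompDr !ccompmN !ccompA piY !ccomp0m hopp0 hadd0r.
by rewrite ccompDl ccompNm h2 h'2; exact: hrefl.
Qed.

Definition cosyz_map X Y (f : arrow X Y) := projT1 (cid (cosyz_ex f)).
Lemma cosyz_mapP X Y (f : arrow X Y) : cosyz_rel f (cosyz_map f).
Proof. exact: projT2 (cid (cosyz_ex f)). Qed.

Definition stable_cat : precat := quocat thru_proj_ideal.

Lemma cosyz_map_uniq X Y (f : arrow X Y) g :
  cosyz_rel f g -> thru_proj (cosyz_map f ⊖ g).
Proof.
apply: cosyz_rel_uniq (cosyz_mapP f).
apply: (inI_heq _ (inI_zero thru_proj_ideal X Y)).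
by rewrite haddNr; exact: hrefl.
Qed.

Definition stable_shift : functor stable_cat stable_cat.
Proof.
refine (@Functor stable_cat stable_cat (cosyz T) cosyz_map _ _ _ _).
- by move=> X Y f g H; apply: cosyz_rel_uniq H _ _; exact: cosyz_mapP.
- move=> X; apply: cosyz_map_uniq; exists (idm _); split; by rewrite !ccomp1m ccompm1; exact: hrefl.
- move=> X Y Z g f; apply: cosyz_map_uniq.
  have [h [h1 h2]] := cosyz_mapP f; have [k [k1 k2]] := cosyz_mapP g.
  exists (k ∘ h); split; first by rewrite -ccompA h1 !ccompA k1; exact: hrefl.
  by rewrite -ccompA h2 !ccompA k2; exact: hrefl.
- move=> X Y f g; apply: cosyz_map_uniq.
  have [h [h1 h2]] := cosyz_mapP f; have [k [k1 k2]] := cosyz_mapP g.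
  by exists (h ⊕ k); rewrite !ccompDl !ccompDr h1 h2 k1 k2; split; exact: hrefl.
Defined.

(* The standard triangle on [u : X -> Y]: the rows of
     X -> fr_inj X -> cosyz X
     |       |          ||
     Y ----> C -----> cosyz X
   are conflations, so that the left hand square is a pushout. *)
Definition standard_triangle X Y Z (u : arrow X Y) (v : arrow Y Z)
    (w : arrow Z (cosyz T X)) :=
  conf v w /\
  exists k : arrow (fr_inj T X) Z, k ∘ ι X ≈ v ∘ u /\ w ∘ k ≈ π X.

Definition stable_dist (X Y Z : stable_cat) (u : arrow X Y) (v : arrow Y Z)
    (w : arrow Z (stable_shift X)) :=
  exists (X' Y' Z' : stable_cat) (u' : arrow X' Y') (v' : arrow Y' Z')
    (w' : arrow Z' (stable_shift X')),
    @standard_triangle X' Y' Z' u' v' w' /\ tri_iso u v w u' v' w'.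

Definition stable : tricat := Tricat stable_dist.
End Exact.
Arguments conf {_ _ _ _} _ _.

Definition full_subcat (C : precat) (P : C -> Prop) : precat.
Proof.
refine (@Precat {X : C | P X} (fun X Y => arrow (sval X) (sval Y))
  (fun _ _ => heq) (fun _ => idm _) (fun _ _ _ => ccomp) (fun _ _ => hzero _ _)
  (fun _ _ => hadd) (fun _ _ => hopp) _ _ _ _ _ _ _ _ _ _ _ _ _) => *.
exact: ccomp_heq. exact: hadd_heq. exact: hopp_heq. exact: ccompA. exact: ccomp1m.
exact: ccompm1. exact: haddA. exact: haddC. exact: hadd0. exact: haddN.
exact: ccompDl. exact: ccompDr.
Defined.

Definition full_subexcat (E : excat) (P : E -> Prop) : excat.
Proof.
refine (@Excat (full_subcat P)
  (fun X Y Z i p => @conf E (sval X) (sval Y) (sval Z) i p) _ _).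
- move=> X Y Z i p /conf_kernel[H U]; split=> // W; exact: U.
- move=> X Y Z i p /conf_cokernel[H U]; split=> // W; exact: U.
Defined.

Definition sub_inclusion (C : precat) (P Q : C -> Prop)
    (PQ : forall X, P X -> Q X) : functor (full_subcat P) (full_subcat Q).
Proof.
refine (@Functor (full_subcat P) (full_subcat Q)
  (fun X => exist _ (sval X) (PQ _ (svalP X))) (fun _ _ f => f) _ _ _ _) => //.
all: by move=> *; exact: hrefl.
Defined.

(* [F] identifies in the target whatever is identified in the source stable
   category; it then induces [stable_functor]. *)
Definition stably_defined (E E' : excat) (T : frobenius E) (T' : frobenius E')
    (F : functor E E') :=
  forall (X Y : E) (f g : arrow X Y),
    @heq (stable T) X Y f g -> @heq (stable T') (F X) (F Y) (fmap F f) (fmap F g).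

Definition stable_functor (E E' : excat) (T : frobenius E) (T' : frobenius E')
    (F : functor E E') (H : stably_defined T T' F) :
  functor (stable T) (stable T').
Proof.
refine (@Functor (stable T) (stable T') F (fun X Y f => fmap F f) H _ _ _) => *.
all: apply: quot_of_heq.
exact: fmap1. exact: fmapM. exact: fmapD.
Defined.

Section Rings.
Variable S : comNzRingType.

Definition is_ideal (I : S -> Prop) :=
  [/\ I 0, forall x y, I x -> I y -> I (x + y) & forall a x, I x -> I (a * x)].

Definition noetherian := forall I : S -> Prop, is_ideal I ->
  exists (n : nat) (e : 'I_n -> S), (forall i, I (e i)) /\
    forall x, I x -> exists c : 'I_n -> S, x = \sum_i c i * e i.

Definition maximal_ideal (m : S -> Prop) :=
  [/\ is_ideal m, ~ m 1 & forall J : S -> Prop, is_ideal J ->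
      (forall x, m x -> J x) -> ~ J 1 -> forall x, J x -> m x].

Definition local_ring (n : S -> Prop) :=
  maximal_ideal n /\
  forall m, maximal_ideal m -> forall x, m x <-> n x.

Definition nonzerodivisor (w : S) := forall x : S, w * x = 0 -> x = 0.
End Rings.

Section Modules.
Variable S : comNzRingType.
Implicit Types M N A B C D G Q : lmodType S.

Definition mklin A B (f : A -> B) (H : linear f) : {linear A -> B} :=
  HB.pack f (GRing.isLinear.Build S A B *:%R f H).

Definition short_exact A B C (f : {linear A -> B}) (g : {linear B -> C}) :=
  [/\ injective f, (forall z, exists y, g y = z)
    & forall y, g y = 0 <-> exists x, f x = y].

Definition fin_gen M := exists (n : nat) (e : 'I_n -> M),
  forall x, exists c : 'I_n -> S, x = \sum_i c i *: e i.

Definition projective_mod M := forall A B (p : {linear A -> B}),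
  (forall b, exists a, p a = b) ->
  forall f : {linear M -> B}, exists g : {linear M -> A}, forall x, p (g x) = f x.

Definition fg_proj M := fin_gen M /\ projective_mod M.

(* Acyclic complexes of finitely generated projective modules which stay
   acyclic under Hom(-, Q) for every finitely generated projective Q. *)
Record tot_acyclic := TotAcyclic {
  tc :> int -> lmodType S;
  td : forall n, {linear tc n -> tc (n + 1)};
  tc_proj : forall n, fg_proj (tc n);
  td_exact : forall n (x : tc (n + 1)), td (n + 1) x = 0 <-> exists y, td n y = x;
  td_coexact : forall Q, fg_proj Q ->
    forall n (u : {linear tc (n + 1) -> Q}), (forall y, u (td n y) = 0) ->
    exists v : {linear tc (n + 1 + 1) -> Q}, forall x, v (td (n + 1) x) = u x
}.

(* [G] is isomorphic to a kernel of a differential of such a complex. *)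
Definition gor_proj G := exists (T : tot_acyclic) (n : int)
  (j : {linear G -> T n}),
  injective j /\ forall x, td T n x = 0 <-> exists g, j g = x.

End Modules.

Section LinearTools.
Variable S : comNzRingType.
Implicit Types A B C D M N P Q : lmodType S.

Definition lpair D A B (f : {linear D -> A}) (g : {linear D -> B}) :
  {linear D -> (A * B)%type}.
Proof.
apply: (@mklin S D (A * B)%type (fun x => (f x, g x))) => a x y.
by rewrite !linearP.
Defined.

Definition lcopair A B D (f : {linear A -> D}) (g : {linear B -> D}) :
  {linear (A * B)%type -> D}.
Proof.
apply: (@mklin S (A * B)%type D (fun x => f x.1 + g x.2)) => a x y /=.
by rewrite !linearP /= scalerDr addrACA.
Defined.

Definition lscale (w : S) A : {linear A -> A}.
Proof.
apply: (@mklin S A A (fun x => w *: x)) => a x y.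
by rewrite scalerDr !scalerA mulrC.
Defined.

Lemma fin_gen_surj A B (f : {linear A -> B}) :
  (forall y, exists x, f x = y) -> fin_gen A -> fin_gen B.
Proof.
move=> sur [n [e He]]; exists n, (f \o e) => y.
have [x <-] := sur y; have [c ->] := He x; exists c.
by rewrite linear_sum; apply: eq_bigr => i _; rewrite linearZ.
Qed.

Lemma fin_gen_prod A B : fin_gen A -> fin_gen B -> fin_gen (A * B)%type.
Proof.
move=> [n [e He]] [m [e' He']].
exists (n + m)%N,
  (fun i => match split i with inl a => (e a, 0) | inr b => (0, e' b) end).
move=> [x y]; have [c ->] := He x; have [c' ->] := He' y.
exists (fun i => match split i with inl a => c a | inr b => c' b end).
rewrite big_split_ord /=.
rewrite (eq_bigr (fun i => (c i *: e i, 0))); last first.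
  by move=> i _; rewrite (unsplitK (inl i)); congr pair; rewrite /= scaler0.
rewrite [X in _ = _ + X](eq_bigr (fun i => (0, c' i *: e' i))); last first.
  by move=> i _; rewrite (unsplitK (inr i)); congr pair; rewrite /= scaler0.
have inl_sum k (F : 'I_k -> A) :
    \sum_i (F i, 0 : B) = (\sum_i F i, 0) :> (A * B)%type.
  by rewrite -(linear_sum (lpair (idfun : {linear A -> A}) (\0 : {linear A -> B}))).
have inr_sum k (F : 'I_k -> B) :
    \sum_i (0 : A, F i) = (0, \sum_i F i) :> (A * B)%type.
  by rewrite -(linear_sum (lpair (\0 : {linear B -> A}) (idfun : {linear B -> B}))).
by rewrite inl_sum inr_sum; congr pair; rewrite /= ?addr0 ?add0r.
Qed.

Lemma fg_proj_prod M N : fg_proj M -> fg_proj N -> fg_proj (M * N)%type.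
Proof.
move=> [fM pM] [fN pN]; split; first exact: fin_gen_prod.
move=> A B p sur f.
have [g1 H1] := pM A B p sur (f \o lpair idfun \0 : {linear M -> B}).
have [g2 H2] := pN A B p sur (f \o lpair \0 idfun : {linear N -> B}).
exists (lcopair g1 g2) => -[x y] /=; rewrite linearD H1 H2 /= -linearD.
by congr (f _); congr pair; rewrite /= ?addr0 ?add0r.
Qed.

(* The complex with all terms [M * M] and differential [(a, b) |-> (0, a)]. *)
Lemma fg_proj_gor_proj M : fg_proj M -> gor_proj M.
Proof.
move=> pM; have pMM := fg_proj_prod pM pM.
pose d : {linear (M * M)%type -> (M * M)%type} := lpair \0 (fst : {linear _ -> _}).
have dE x : d x = (0, x.1) by [].
have ex (x : M * M) : d x = 0 <-> exists y, d y = x.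
  split=> [|[y <-]]; last by rewrite !dE.
  by rewrite dE; case: x => a b [/= ->]; exists (b, 0).
have co Q : fg_proj Q -> forall (n : int) (u : {linear (M * M)%type -> Q}),
    (forall y, u (d y) = 0) ->
    exists v : {linear (M * M)%type -> Q}, forall x, v (d x) = u x.
  move=> _ _ u ud; exists (u \o lpair (snd : {linear _ -> _}) \0 : {linear _ -> _}).
  move=> [a b] /=; apply/eqP; rewrite -subr_eq0 -linearB -oppr_eq0 -linearN.
  apply/eqP; rewrite -[RHS](ud (b, 0)); congr (u _).
  by rewrite dE; congr pair; rewrite /= ?subrr ?oppr0 // opprB subr0.
pose T := @TotAcyclic S (fun _ => (M * M)%type) (fun _ => d) (fun _ => pMM)
  (fun _ => ex) co.
exists T, 0, (lpair \0 idfun); split=> [x y [] //|x]; split=> [|[g <-]] /=.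
  by move=> h; have {h} : d x = 0 := h; rewrite dE; case: x => a b [/= ->]; exists b.
exact: (dE (0, g)).
Qed.
End LinearTools.

Section Categories.
Variable S : comNzRingType.
Implicit Types A B C D : lmodType S.

Record mor := Mor {
  src : lmodType S;
  tgt : lmodType S;
  arr :> {linear src -> tgt};
  src_fg : fin_gen src;
  tgt_fg : fin_gen tgt
}.

Record mor_hom (X Y : mor) := MorHom {
  hom1 : {linear src X -> src Y};
  hom0 : {linear tgt X -> tgt Y};
  hom_comm : forall x, hom0 (X x) = Y (hom1 x)
}.

Definition mor_eq X Y (f g : mor_hom X Y) :=
  (forall x, hom1 f x = hom1 g x) /\ (forall x, hom0 f x = hom0 g x).

Definition mor_id X : mor_hom X X :=
  @MorHom X X (idfun : {linear _ -> _}) (idfun : {linear _ -> _})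
    (fun=> erefl).

Program Definition mor_comp X Y Z (g : mor_hom Y Z) (f : mor_hom X Y) :
  mor_hom X Z :=
  @MorHom X Z (hom1 g \o hom1 f : {linear _ -> _})
    (hom0 g \o hom0 f : {linear _ -> _}) _.
Next Obligation. by rewrite !hom_comm. Qed.

Program Definition mor_zero X Y : mor_hom X Y :=
  @MorHom X Y (\0 : {linear _ -> _}) (\0 : {linear _ -> _}) _.
Next Obligation. by rewrite linear0. Qed.

Program Definition mor_add X Y (f g : mor_hom X Y) : mor_hom X Y :=
  @MorHom X Y (hom1 f \+ hom1 g : {linear _ -> _})
    (hom0 f \+ hom0 g : {linear _ -> _}) _.
Next Obligation. by rewrite !hom_comm linearD. Qed.

Program Definition mor_opp X Y (f : mor_hom X Y) : mor_hom X Y :=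
  @MorHom X Y (\- hom1 f : {linear _ -> _}) (\- hom0 f : {linear _ -> _}) _.
Next Obligation. by rewrite !hom_comm linearN. Qed.

Definition MorCat : precat.
Proof.
refine (@Precat mor mor_hom mor_eq mor_id mor_comp mor_zero mor_add mor_opp
  _ _ _ _ _ _ _ _ _ _ _ _ _).
- move=> X Y; split=> [f|f g [H K]|f g h [H K] [H' K']]; split=> x //.
  by rewrite H H'. by rewrite K K'.
- by move=> X Y Z g g' f f' [H K] [H' K']; split=> x /=; rewrite ?H ?K ?H' ?K'.
- by move=> X Y f f' g g' [H K] [H' K']; split=> x /=; rewrite ?H ?K ?H' ?K'.
- by move=> X Y f f' [H K]; split=> x /=; rewrite ?H ?K.
all: move=> *; split=> x //=.
all: by rewrite ?addrA ?add0r ?addNr ?linearD // addrC.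
Defined.

Definition mor_conf (X Y Z : MorCat) (i : arrow X Y) (p : arrow Y Z) :=
  short_exact (hom1 i) (hom1 p) /\ short_exact (hom0 i) (hom0 p).

Lemma lin_ex A B (R : A -> B -> Prop) :
  (forall x, exists y, R x y) -> (forall x y z, R x y -> R x z -> y = z) ->
  (forall a x x' y y', R x y -> R x' y' -> R (a *: x + x') (a *: y + y')) ->
  exists f : {linear A -> B}, forall x, R x (f x).
Proof.
move=> ex un li; pose f x := projT1 (cid (ex x)).
have fP x : R x (f x) := projT2 (cid (ex x)).
have lf : linear f by move=> a x y; apply: un (fP _) _; exact: li.
by exists (mklin lf).
Qed.

Lemma short_exact_ker A B C D (f : {linear A -> B}) (g : {linear B -> C})
    (t : {linear D -> B}) : short_exact f g -> (forall x, g (t x) = 0) ->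
  exists s : {linear D -> A}, forall x, f (s x) = t x.
Proof.
move=> [inj _ ex] gt; apply: (lin_ex (R := fun x y => f y = t x)).
- by move=> x; apply/ex.
- by move=> x y z <- /inj.
- by move=> a x x' y y'; rewrite !linearP => -> ->.
Qed.

Lemma short_exact_coker A B C D (f : {linear A -> B}) (g : {linear B -> C})
    (t : {linear B -> D}) : short_exact f g -> (forall x, t (f x) = 0) ->
  exists s : {linear C -> D}, forall x, s (g x) = t x.
Proof.
move=> [_ sur ex] tf.
have [||| s Hs] := @lin_ex C D (fun x y => exists2 z, g z = x & t z = y).
- by move=> x; have [y <-] := sur x; exists (t y); exists y.
- move=> x y z [u <- <-] [v e <-].
  have /ex[a Ha] : g (u - v) = 0 by rewrite linearB e subrr.
  by apply/eqP; rewrite -subr_eq0 -linearB -Ha tf.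
- move=> a x x' y y' [z <- <-] [z' <- <-].
  by exists (a *: z + z'); rewrite linearP.
exists s => x; have [z e <-] := Hs (g x).
have /ex[a Ha] : g (z - x) = 0 by rewrite linearB e subrr.
by apply/eqP; rewrite -subr_eq0 -linearB -Ha tf.
Qed.

Definition MorEx : excat.
Proof.
refine (@Excat MorCat mor_conf _ _).
- move=> X Y Z i p [E1 E0]; split.
    have [_ _ e1] := E1; have [_ _ e0] := E0.
    by split=> x /=; [apply/e1|apply/e0]; exists x.
  move=> W t [/= t1 t0].
  have [s1 h1] := short_exact_ker E1 t1.
  have [s0 h0] := short_exact_ker E0 t0.
  have [j1 _ _] := E1; have [j0 _ _] := E0.
  have c x : s0 (W x) = X (s1 x).
    by apply: j0; rewrite h0 hom_comm hom_comm h1.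
  exists (MorHom c); split=> // s' [k1 k0].
  by split=> x /=; [apply: j1; rewrite h1; exact: k1|apply: j0; rewrite h0; exact: k0].
- move=> X Y Z i p [E1 E0]; split.
    have [_ _ e1] := E1; have [_ _ e0] := E0.
    by split=> x /=; [apply/e1|apply/e0]; exists x.
  move=> W t [/= t1 t0].
  have [s1 h1] := short_exact_coker E1 t1.
  have [s0 h0] := short_exact_coker E0 t0.
  have [_ j1 _] := E1; have [_ j0 _] := E0.
  have c x : s0 (Z x) = W (s1 x).
    by have [y <-] := j1 x; rewrite -hom_comm h0 h1 hom_comm.
  exists (MorHom c); split=> // s' [k1 k0]; split=> x /=.
    by have [y <-] := j1 x; rewrite h1; exact: k1.
  by have [y <-] := j0 x; rewrite h0; exact: k0.
Defined.

Variable w : S.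

(* Monomorphisms [G -> P] whose cokernel is killed by [w], that is, with image
   containing [w P]. *)
Definition is_mon (X : lmodType S -> Prop) (f : MorEx) :=
  [/\ X (src f), fg_proj (tgt f), injective f
    & forall y, exists x, f x = w *: y].

Definition Mon (X : lmodType S -> Prop) : excat := full_subexcat (is_mon X).

Definition MonP := Mon (@fg_proj S).
Definition MonG := Mon (@gor_proj S).

Lemma MonP_MonG (f : MorEx) : is_mon (@fg_proj S) f -> is_mon (@gor_proj S) f.
Proof. by case=> ? ? ? ?; split=> //; exact: fg_proj_gor_proj. Qed.

Definition Mon_inclusion : functor MonP MonG := sub_inclusion MonP_MonG.

Record mf := MF {
  mf1 : lmodType S;
  mf0 : lmodType S;
  mf1_proj : fg_proj mf1;
  mf0_proj : fg_proj mf0;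
  rho1 : {linear mf1 -> mf0};
  rho0 : {linear mf0 -> mf1};
  rho01 : forall x, rho0 (rho1 x) = w *: x;
  rho10 : forall x, rho1 (rho0 x) = w *: x
}.

Record mf_hom (X Y : mf) := MFHom {
  psi1 : {linear mf1 X -> mf1 Y};
  psi0 : {linear mf0 X -> mf0 Y};
  psi_rho0 : forall x, psi1 (rho0 X x) = rho0 Y (psi0 x);
  psi_rho1 : forall x, rho1 Y (psi1 x) = psi0 (rho1 X x)
}.

Definition mf_eq X Y (f g : mf_hom X Y) :=
  (forall x, psi1 f x = psi1 g x) /\ (forall x, psi0 f x = psi0 g x).

Definition mf_id X : mf_hom X X :=
  @MFHom X X (idfun : {linear _ -> _}) (idfun : {linear _ -> _})
    (fun=> erefl) (fun=> erefl).

Program Definition mf_comp X Y Z (g : mf_hom Y Z) (f : mf_hom X Y) :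
  mf_hom X Z :=
  @MFHom X Z (psi1 g \o psi1 f : {linear _ -> _})
    (psi0 g \o psi0 f : {linear _ -> _}) _ _.
Next Obligation. by rewrite !psi_rho0. Qed.
Next Obligation. by rewrite !psi_rho1. Qed.

Program Definition mf_zero X Y : mf_hom X Y :=
  @MFHom X Y (\0 : {linear _ -> _}) (\0 : {linear _ -> _}) _ _.
Next Obligation. by rewrite linear0. Qed.
Next Obligation. by rewrite linear0. Qed.

Program Definition mf_add X Y (f g : mf_hom X Y) : mf_hom X Y :=
  @MFHom X Y (psi1 f \+ psi1 g : {linear _ -> _})
    (psi0 f \+ psi0 g : {linear _ -> _}) _ _.
Next Obligation. by rewrite !psi_rho0 linearD. Qed.
Next Obligation. by rewrite linearD !psi_rho1. Qed.

Program Definition mf_opp X Y (f : mf_hom X Y) : mf_hom X Y :=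
  @MFHom X Y (\- psi1 f : {linear _ -> _}) (\- psi0 f : {linear _ -> _}) _ _.
Next Obligation. by rewrite !psi_rho0 linearN. Qed.
Next Obligation. by rewrite linearN !psi_rho1. Qed.

Definition Pair : precat.
Proof.
refine (@Precat mf mf_hom mf_eq mf_id mf_comp mf_zero mf_add mf_opp
  _ _ _ _ _ _ _ _ _ _ _ _ _).
- move=> X Y; split=> [f|f g [H K]|f g h [H K] [H' K']]; split=> x //.
  by rewrite H H'. by rewrite K K'.
- by move=> X Y Z g g' f f' [H K] [H' K']; split=> x /=; rewrite ?H ?K ?H' ?K'.
- by move=> X Y f f' g g' [H K] [H' K']; split=> x /=; rewrite ?H ?K ?H' ?K'.
- by move=> X Y f f' [H K]; split=> x /=; rewrite ?H ?K.
all: move=> *; split=> x //=.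
all: by rewrite ?addrA ?add0r ?addNr ?linearD // addrC.
Defined.

Definition null_homotopic (X Y : Pair) (f : arrow X Y) :=
  exists (s0 : {linear mf0 X -> mf1 Y}) (s1 : {linear mf1 X -> mf0 Y}),
    (forall x, psi0 f x = rho1 Y (s0 x) + s1 (rho0 X x)) /\
    (forall x, psi1 f x = s0 (rho1 X x) + rho0 Y (s1 x)).

Definition null_homotopic_ideal : ideal Pair.
Proof.
refine (@Ideal Pair null_homotopic _ _ _ _).
- move=> X Y f g [H1 H0] [s0 [s1 [K0 K1]]]; exists s0, s1.
  by split=> x; rewrite -?H1 -?H0.
- move=> X Y f g [s0 [s1 [K0 K1]]] [t0 [t1 [L0 L1]]].
  exists (s0 \+ t0 : {linear _ -> _}), (s1 \+ t1 : {linear _ -> _}).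
  by split=> x /=; rewrite ?K0 ?K1 ?L0 ?L1 linearD addrACA.
- move=> X Y; exists (\0 : {linear _ -> _}), (\0 : {linear _ -> _}).
  by split=> x /=; rewrite linear0 addr0.
- move=> X Y Z W h g f [s0 [s1 [K0 K1]]].
  exists (psi1 h \o s0 \o psi0 f : {linear _ -> _}),
         (psi0 h \o s1 \o psi1 f : {linear _ -> _}).
  split=> x /=.
    by rewrite K0 linearD psi_rho1 psi_rho0.
  by rewrite K1 linearD psi_rho1 psi_rho0.
Defined.

Definition DBcat : precat := quocat null_homotopic_ideal.

Program Definition mf_shift (X : mf) : mf :=
  @MF (mf0 X) (mf1 X) (mf0_proj X) (mf1_proj X)
    (\- rho0 X : {linear _ -> _}) (\- rho1 X : {linear _ -> _}) _ _.
Next Obligation. by rewrite linearN opprK rho10. Qed.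
Next Obligation. by rewrite linearN opprK rho01. Qed.

Program Definition mf_shift_hom X Y (f : mf_hom X Y) :
  mf_hom (mf_shift X) (mf_shift Y) :=
  @MFHom (mf_shift X) (mf_shift Y) (psi0 f) (psi1 f) _ _.
Next Obligation. by rewrite linearN psi_rho1. Qed.
Next Obligation. by rewrite linearN psi_rho0. Qed.

Definition DB_shift : functor DBcat DBcat.
Proof.
refine (@Functor DBcat DBcat mf_shift mf_shift_hom _ _ _ _).
- move=> X Y f g [s0 [s1 [/= H0 H1]]].
  exists (\- s1 : {linear _ -> _}), (\- s0 : {linear _ -> _}).
  by split=> x /=; rewrite ?H0 ?H1 !linearN !opprK addrC.
all: by move=> *; apply: quot_of_heq; split.
Defined.

Section Cone.
Variables (X Y : mf) (f : mf_hom X Y).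

Definition cone_fun1 (x : mf1 Y * mf0 X) : mf0 Y * mf1 X :=
  (rho1 Y x.1 + psi0 f x.2, - rho0 X x.2).
Definition cone_fun0 (x : mf0 Y * mf1 X) : mf1 Y * mf0 X :=
  (rho0 Y x.1 + psi1 f x.2, - rho1 X x.2).
Lemma cone_fun1_linear : linear cone_fun1.
Proof.
move=> a x y; rewrite /cone_fun1 /= !linearP /=.
by congr pair; rewrite /= ?scalerDr ?opprD ?scalerN //= addrACA.
Qed.
Lemma cone_fun0_linear : linear cone_fun0.
Proof.
move=> a x y; rewrite /cone_fun0 /= !linearP /=.
by congr pair; rewrite /= ?scalerDr ?opprD ?scalerN //= addrACA.
Qed.

Program Definition cone : mf :=
  @MF (mf1 Y * mf0 X)%type (mf0 Y * mf1 X)%type _ _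
    (mklin cone_fun1_linear) (mklin cone_fun0_linear) _ _.
Next Obligation. exact: fg_proj_prod (mf1_proj Y) (mf0_proj X). Qed.
Next Obligation. exact: fg_proj_prod (mf0_proj Y) (mf1_proj X). Qed.
Next Obligation.
rewrite /cone_fun0 /cone_fun1 /= linearD rho01 -psi_rho0 !linearN rho10 opprK.
by rewrite addrK.
Qed.
Next Obligation.
rewrite /cone_fun0 /cone_fun1 /= linearD rho10 psi_rho1 !linearN rho01 opprK.
by rewrite addrK.
Qed.

Program Definition cone_in : mf_hom Y cone :=
  @MFHom Y cone (lpair idfun \0) (lpair idfun \0) _ _.
Next Obligation. by rewrite /cone_fun0 /= !linear0 addr0. Qed.
Next Obligation. by rewrite /cone_fun1 /= !linear0 addr0. Qed.

Program Definition cone_out : mf_hom cone (mf_shift X) :=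
  @MFHom cone (mf_shift X) (snd : {linear _ -> _}) (snd : {linear _ -> _})
    (fun=> erefl) (fun=> erefl).
End Cone.

Definition DB_dist (X Y Z : DBcat) (u : arrow X Y) (v : arrow Y Z)
    (h : arrow Z (DB_shift X)) :=
  exists (X' Y' : DBcat) (f : arrow X' Y'),
    @tri_iso DBcat DB_shift X Y Z X' Y' (cone f) u v h
      f (cone_in f) (cone_out f).

Definition DB : tricat := Tricat DB_dist.
End Categories.

Module MonFrobenius.
Section Structure.
Variables (S : comNzRingType) (w : S).
Hypothesis w_reg : nonzerodivisor w.
Implicit Types A B C D G K M N P Q : lmodType S.

Lemma fg_proj_reg M : fg_proj M -> forall x : M, w *: x = 0 -> x = 0.
Proof.
move=> [[n [e He]] pM] x wx.
have lp : linear (fun c : 'rV[S]_n => \sum_i c 0 i *: e i).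
  move=> a c c'; rewrite scaler_sumr -big_split; apply: eq_bigr => i _ /=.
  by rewrite !mxE scalerDl scalerA.
have [|s Hs] := pM _ _ (mklin lp) _ idfun.
  by move=> b; have [c ->] := He b; exists (\row_i c i); apply: eq_bigr => i _; rewrite mxE.
have s0 : s x = 0.
  have ws : w *: s x = 0 by rewrite -linearZ wx linear0.
  apply/rowP => i; have := congr1 (fun v : 'rV_n => v 0 i) ws.
  by rewrite !mxE; exact: w_reg.
by rewrite -[x]/(idfun x) -Hs s0 linear0.
Qed.

Variable X : lmodType S -> Prop.
Hypothesis X_proj : forall M, fg_proj M -> X M.
Hypothesis X_fg : forall M, X M -> fin_gen M.
Hypothesis X_prod : forall M N, X M -> X N -> X (M * N)%type.
Hypothesis X_emb : forall G, X G -> exists Q C (j : {linear G -> Q})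
  (c : {linear Q -> C}), [/\ fg_proj Q, X C & short_exact j c].
Hypothesis X_cov : forall G, X G -> exists K A (i : {linear K -> A})
  (e : {linear A -> G}), [/\ fg_proj A, X K & short_exact i e].
Hypothesis X_ext : forall A B C P (f : {linear A -> B}) (g : {linear B -> C}),
  X C -> fg_proj P -> short_exact f g -> forall u : {linear A -> P},
  exists v : {linear B -> P}, forall x, v (f x) = u x.

Local Notation E := (Mon w X).
Local Open Scope cat_scope.

Definition mkmon G P (f : {linear G -> P}) (hG : X G) (hP : fg_proj P)
  (hf : injective f) (hw : forall y, exists x, f x = w *: y) : E :=
  exist (is_mon w X) (@Mor S G P f (X_fg hG) (proj1 hP)) (And4 hG hP hf hw).

Definition ar (Z : E) : {linear src (sval Z) -> tgt (sval Z)} := arr (sval Z).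
Definition E1 (Z : E) := src (sval Z).
Definition E0 (Z : E) := tgt (sval Z).

Lemma back_ex (Z : E) : exists g : {linear E0 Z -> E1 Z},
  forall y, ar Z (g y) = w *: y.
Proof.
have [_ _ inj ex] := svalP Z.
apply: (lin_ex (R := fun y x => ar Z x = w *: y)) => //.
  by move=> y x x' <- /inj.
by move=> a y y' x x'; rewrite linearP => -> ->; rewrite scalerDr !scalerA mulrC.
Qed.
Definition back Z := projT1 (cid (back_ex Z)).
Lemma backP Z y : ar Z (back Z y) = w *: y.
Proof. exact: projT2 (cid (back_ex Z)) y. Qed.
Lemma ar_inj Z : injective (ar Z).
Proof. by case: (svalP Z). Qed.
Lemma backP' Z x : back Z (ar Z x) = w *: x.
Proof. by apply: ar_inj; rewrite backP linearZ. Qed.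
Lemma ar_nat (Y Z : E) (t : arrow Y Z) x : hom0 t (ar Y x) = ar Z (hom1 t x).
Proof. exact: hom_comm. Qed.
Lemma back_nat (Y Z : E) (t : arrow Y Z) y : hom1 t (back Y y) = back Z (hom0 t y).
Proof.
apply: ar_inj; rewrite backP -[ar Z]/(arr (sval Z)) -hom_comm.
by rewrite -[arr _]/(ar Y) backP linearZ.
Qed.

(* The projective-injective objects (A = A) + (B --w--> B). *)
Section J.
Variables A B : lmodType S.
Hypotheses (pA : fg_proj A) (pB : fg_proj B).
Definition Jar : {linear (A * B)%type -> (A * B)%type} :=
  lpair (fst : {linear _ -> _}) (lscale w B \o snd : {linear _ -> _}).
Lemma Jar_inj : injective Jar.
Proof.
move=> [a b] [a' b'] [/= -> H]; congr pair.
apply/eqP; rewrite -subr_eq0; apply/eqP; apply: fg_proj_reg => //.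
by rewrite scalerBr H subrr.
Qed.
Lemma Jar_w y : exists x, Jar x = w *: y.
Proof. by case: y => a b; exists (w *: a, b). Qed.
Definition J : E := mkmon (X_proj (fg_proj_prod pA pB)) (fg_proj_prod pA pB) Jar_inj Jar_w.

Lemma J_out (Z : E) (a : {linear A -> E1 Z}) (b : {linear B -> E0 Z}) :
  exists t : arrow J Z, (forall x, hom1 t x = a x.1 + back Z (b x.2)) /\
     forall x, hom0 t x = ar Z (a x.1) + b x.2.
Proof.
have c (x : src (sval J)) : lcopair (ar Z \o a : {linear _ -> _}) b (arr (sval J) x) =
   arr (sval Z) (lcopair a (back Z \o b : {linear _ -> _}) x).
  by rewrite /= linearD -!/(ar Z) backP linearZ.
by exists (@MorHom S (sval J) (sval Z) _ _ c).
Qed.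

Lemma J_proj : projective_obj J.
Proof.
move=> U V W i p [[_ sp1 _] [_ sp0 _]] t.
pose ta : {linear A -> E1 W} := hom1 t \o lpair idfun \0.
pose tb : {linear B -> E0 W} := hom0 t \o lpair \0 idfun.
have [a Ha] := (proj2 pA) _ _ (hom1 p) sp1 ta.
have [b Hb] := (proj2 pB) _ _ (hom0 p) sp0 tb.
have [s [s1 s0]] := @J_out V a b; exists s.
have e (x : A * B) : x = (x.1, 0) + (0, x.2).
  by case: x => x y; congr pair; rewrite /= ?addr0 ?add0r.
split=> x /=.
  rewrite s1 linearD Ha back_nat Hb [in RHS](e x) [RHS]linearD; congr (_ + _).
  apply: etrans (esym (back_nat t _)) _; congr (hom1 t _); apply: ar_inj.
  by rewrite backP; congr pair; rewrite /= ?scaler0.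
rewrite s0 linearD Hb [in RHS](e x) [RHS]linearD; congr (_ + _).
apply: etrans (ar_nat p _) _; rewrite Ha; apply: etrans (esym (ar_nat t _)) _.
congr (hom0 t _).
by congr pair; rewrite /= ?scaler0.
Qed.

Lemma J_in (Z : E) (a : {linear E0 Z -> A}) (b : {linear E1 Z -> B}) :
  exists t : arrow Z J, (forall x, hom1 t x = (a (ar Z x), b x)) /\
     forall y, hom0 t y = (a y, b (back Z y)).
Proof.
have c (x : src (sval Z)) : lpair a (b \o back Z : {linear _ -> _}) (arr (sval Z) x) =
   arr (sval J) (lpair (a \o ar Z : {linear _ -> _}) b x).
  by rewrite /= -/(ar Z) backP' linearZ.
by exists (@MorHom S (sval Z) (sval J) _ _ c).
Qed.

Lemma J_inj : injective_obj J.
Proof.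
move=> U V W i p [se1 se0] t.
pose ta : {linear E0 U -> A} := fst \o hom0 t.
pose tb : {linear E1 U -> B} := snd \o hom1 t.
have [XW1 pW0 _ _] := svalP W.
have [a Ha] := X_ext (X_proj pW0) pA se0 ta.
have [b Hb] := X_ext XW1 pB se1 tb.
have [s [s1 s0]] := @J_in V a b; exists s; split=> x /=.
  rewrite s1 Hb /tb; have -> : ar V (hom1 i x) = hom0 i (ar U x) := esym (ar_nat i x).
  rewrite Ha /ta /=; have -> : hom0 t (ar U x) = Jar (hom1 t x) := ar_nat t x.
  by rewrite [RHS]surjective_pairing.
rewrite s0; have -> : back V (hom0 i x) = hom1 i (back U x) := esym (back_nat i x).
rewrite Hb /tb Ha /ta /=.
have -> : hom1 t (back U x) = back J (hom0 t x) := back_nat t x.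
rewrite [RHS]surjective_pairing; congr pair.
have : snd (Jar (back J (hom0 t x))) = snd (w *: hom0 t x) := congr1 snd (@backP J _).
rewrite /= => H; apply/eqP; rewrite -subr_eq0; apply/eqP; apply: (fg_proj_reg pB).
by rewrite scalerBr H subrr.
Qed.
End J.

Lemma X_reg C : X C -> forall x : C, w *: x = 0 -> x = 0.
Proof.
move=> /X_emb[Q [D [j [c [pQ _ [ji _ _]]]]]] x wx; apply: ji.
by rewrite linear0; apply: (fg_proj_reg pQ); rewrite -linearZ wx linear0.
Qed.

Lemma enough_inj (Z : E) : exists (I Y : E) (i : arrow Z I) (p : arrow I Y),
  [/\ conf i p, injective_obj I & projective_obj I].
Proof.
have [XG pP fi fw] := svalP Z; pose f := ar Z; pose g := back Z.
have gf x : g (f x) = w *: x := backP' x.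
have fg x : f (g x) = w *: x := backP x.
have [Q [C [j [c [pQ XC se]]]]] := X_emb XG.
have [h hj] := X_ext XC pP se f.
pose t : {linear Q -> Q} := lscale w Q \- (j \o g \o h).
have tE q : t q = w *: q - j (g (h q)) by [].
have [x|k kE] := short_exact_coker (t := t) se.
  by rewrite tE hj gf linearZ subrr.
pose psi : {linear (E0 Z * C)%type -> Q} := lcopair (\- (j \o g)) k.
have psiE p q : psi (p, c q) = w *: q - j (g (p + h q)).
  by rewrite /= kE tE !linearD addrCA.
have [ji cs ex] := se.
have psi_inj : injective psi.
  have K p d : psi (p, d) = 0 -> (p, d) = 0.
    have [q <-] := cs d; rewrite psiE => /eqP; rewrite subr_eq0 => /eqP H.
    have cq0 : c q = 0.
      apply: (X_reg XC); rewrite -linearZ H; apply/ex; by exists (g (p + h q)).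
    have [x Hx] := proj1 (ex q) cq0.
    move: H; rewrite -Hx hj -linearZ => /ji; rewrite linearD gf => H.
    have : g p = 0 by apply: (addIr (w *: x)); rewrite add0r -H.
    move=> /(congr1 f); rewrite fg linear0 => /(fg_proj_reg pP) ->.
    by rewrite Hx cq0.
  move=> x y /eqP; rewrite -subr_eq0 -linearB => /eqP.
  by rewrite [x - y]surjective_pairing => /K; rewrite -surjective_pairing => /eqP; rewrite subr_eq0 => /eqP.
have psi_w y : exists x, psi x = w *: y.
  by exists (- h y, c y); rewrite psiE addNr !linear0 addr0.
pose Y : E := mkmon (X_prod (X_proj pP) XC) pQ psi_inj psi_w.
have [i [i1 i0]] := @J_in _ _ pP pQ Z idfun j.
pose p1 : {linear (E0 Z * Q)%type -> (E0 Z * C)%type} :=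
  lpair (fst \- (h \o snd)) (c \o snd : {linear _ -> _}).
pose p0 : {linear (E0 Z * Q)%type -> Q} := snd \- (j \o g \o fst).
have cm (x : src (sval (J pP pQ))) : p0 (arr (sval (J pP pQ)) x) = arr (sval Y) (p1 x).
  case: x => p q; rewrite /p1 [RHS]psiE /p0 /= subrK. by [].
exists (J pP pQ), Y, i, (@MorHom S (sval (J pP pQ)) (sval Y) p1 p0 cm).
split; [|exact: J_inj|exact: J_proj].
split; split=> /=.
- by move=> x y; rewrite !i1 => -[_ /ji].
- by move=> [p d]; have [q <-] := cs d; exists (p + h q, q); rewrite /= addrK.
- move=> [p q]; split=> [[/= H1 H2]|[x Hx]].
    have [x Hx] := proj1 (ex q) H2; exists x; rewrite i1 Hx; congr pair => /=.
    by apply/eqP; rewrite eq_sym -subr_eq0 -[X in _ - X]hj Hx H1.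
  have -> : (p, q) = (f x, j x) by rewrite -Hx i1.
  congr pair; rewrite /= ?hj ?subrr //; apply/ex; by exists x.
- by move=> x y; rewrite !i0 => -[].
- by move=> q; exists (0, q); rewrite /= !linear0 addr0.
- move=> [p q]; split=> [/= /eqP|[x <-]].
    by rewrite subr_eq0 => /eqP ->; exists p; rewrite i0.
  by rewrite i0 /= subrr.
Qed.

Lemma enough_proj (Z : E) : exists (K P : E) (i : arrow K P) (p : arrow P Z),
  [/\ conf i p, projective_obj P & injective_obj P].
Proof.
have [XG pP fi fw] := svalP Z; pose f := ar Z; pose g := back Z.
have gf x : g (f x) = w *: x := backP' x.
have fg x : f (g x) = w *: x := backP x.
have [K [A [k [e [pA XK [ki es ex]]]]]] := X_cov XG.
have [h eh] := (proj2 pP) _ _ e es g.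
pose psi : {linear (K * E0 Z)%type -> A} := lcopair k (\- h).
have psiE x p : psi (x, p) = k x - h p by [].
have psi_inj : injective psi.
  have L x p : psi (x, p) = 0 -> (x, p) = 0.
    rewrite psiE => /eqP; rewrite subr_eq0 => /eqP H.
    have gp : g p = 0 by rewrite -eh -H; apply/ex; exists x.
    have p0 : p = 0 by apply: (fg_proj_reg pP); rewrite -fg gp linear0.
    by move: H; rewrite p0 linear0 -[RHS](linear0 k) => /ki ->.
  move=> x y /eqP; rewrite -subr_eq0 -linearB => /eqP.
  by rewrite [x - y]surjective_pairing => /L; rewrite -surjective_pairing => /eqP; rewrite subr_eq0 => /eqP.
have psi_w a : exists x, psi x = w *: a.
  have [x Hx] : exists x, k x = w *: a - h (f (e a)).
    by apply/ex; rewrite linearB eh gf linearZ subrr.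
  by exists (x, - f (e a)); rewrite psiE Hx linearN opprK subrK.
pose Y : E := mkmon (X_prod XK (X_proj pP)) pA psi_inj psi_w.
have [p [p1 p0]] := @J_out _ _ pA pP Z e idfun.
pose i1 : {linear (K * E0 Z)%type -> (A * E0 Z)%type} := lpair psi (snd : {linear _ -> _}).
pose i0 : {linear A -> (A * E0 Z)%type} := lpair idfun (\- (f \o e)).
have cm (x : src (sval Y)) : i0 (arr (sval Y) x) = arr (sval (J pA pP)) (i1 x).
  case: x => x q; congr pair => /=.
  have ek : e (k x) = 0 by apply/ex; exists x.
  by rewrite linearD !linearN eh linearD !linearN ek linear0 add0r fg opprK.
exists Y, (J pA pP), (@MorHom S (sval Y) (sval (J pA pP)) i1 i0 cm), p.
split; [|exact: J_proj|exact: J_inj].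
split; split=> /=.
- by move=> x y [/psi_inj].
- by move=> x; have [a <-] := es x; exists (a, 0); rewrite p1 /= linear0 addr0.
- move=> [a q]; rewrite p1 /=; split=> [H|[[x q'] [<- <-]]] /=.
    have [x Hx] : exists x, k x = a + h q by apply/ex; rewrite linearD eh.
    by exists (x, q); congr pair; rewrite /= Hx addrK.
  have ek : e (k x) = 0 by apply/ex; exists x.
  by rewrite linearD !linearN eh ek add0r addNr.
- by move=> x y [].
- by move=> y; exists (0, y); rewrite p0 /= !linear0 add0r.
- move=> [a q]; rewrite p0 /=; split=> [|[x [<- <-]]]; last by rewrite subrr.
  by move=> /eqP; rewrite addrC addr_eq0 => /eqP ->; exists a.
Qed.

Lemma biprod (U V : E) : exists Z i j p q, @is_biproduct E U V Z i j p q.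
Proof.
have [XU pU iU wU] := svalP U; have [XV pV iV wV] := svalP V.
pose f : {linear (E1 U * E1 V)%type -> (E0 U * E0 V)%type} :=
  lpair (ar U \o fst : {linear _ -> _}) (ar V \o snd : {linear _ -> _}).
have fi : injective f by move=> [a b] [c d] [/iU -> /iV ->].
have fw y : exists x, f x = w *: y.
  case: y => a b; have [x Hx] := wU a; have [y Hy] := wV b.
  by exists (x, y); congr pair.
pose Z : E := mkmon (X_prod XU XV) (fg_proj_prod pU pV) fi fw.
have ci (x : src (sval U)) : (lpair idfun \0 : {linear E0 U -> (E0 U * E0 V)%type}) (arr (sval U) x) =
  arr (sval Z) ((lpair idfun \0 : {linear E1 U -> (E1 U * E1 V)%type}) x).
  by congr pair; rewrite /= linear0.
have cj (x : src (sval V)) : (lpair \0 idfun : {linear E0 V -> (E0 U * E0 V)%type}) (arr (sval V) x) =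
  arr (sval Z) ((lpair \0 idfun : {linear E1 V -> (E1 U * E1 V)%type}) x).
  by congr pair; rewrite /= linear0.
exists Z, (@MorHom S (sval U) (sval Z) _ _ ci), (@MorHom S (sval V) (sval Z) _ _ cj).
exists (@MorHom S (sval Z) (sval U) (fst : {linear _ -> _}) (fst : {linear _ -> _}) (fun=> erefl)).
exists (@MorHom S (sval Z) (sval V) (snd : {linear _ -> _}) (snd : {linear _ -> _}) (fun=> erefl)).
split; split=> //= -[x y]; by congr pair; rewrite /= ?addr0 ?add0r.
Qed.

Lemma proj_inj (Z : E) : projective_obj Z <-> injective_obj Z.
Proof.
split=> H.
  have [Y [P [i [r [cf _ iP]]]]] := enough_proj Z.
  have [s rs] := H _ _ _ _ _ cf (idm Z).
  move=> U V W j p cf' t; have [u Hu] := iP _ _ _ _ _ cf' (s ∘ t).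
  by exists (r ∘ u); rewrite -ccompA Hu ccompA rs ccomp1m; exact: hrefl.
have [I [Y [s [p [cf _ pI]]]]] := enough_inj Z.
have [r rs] := H _ _ _ _ _ cf (idm Z).
move=> U V W j q cf' t; have [u Hu] := pI _ _ _ _ _ cf' (t ∘ r).
by exists (u ∘ s); rewrite ccompA Hu -ccompA rs ccompm1; exact: hrefl.
Qed.

Lemma Mon_frobenius : inhabited (frobenius E).
Proof.
pose HI Z := cid (enough_inj Z); pose HY Z := cid (projT2 (HI Z)).
pose Hi Z := cid (projT2 (HY Z)); pose Hp Z := cid (projT2 (Hi Z)).
constructor; apply: (@Frobenius E biprod (fun Z => projT1 (HI Z))
  (fun Z => projT1 (HY Z)) (fun Z => projT1 (Hi Z)) (fun Z => projT1 (Hp Z))).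
- by move=> Z; case: (projT2 (Hp Z)).
- by move=> Z; case: (projT2 (Hp Z)).
- by move=> Z; have [K [P [i [p [cf pP _]]]]] := enough_proj Z; exists K, P, i, p.
- exact: proj_inj.
Qed.
End Structure.

Section Ker.
Variables (S : comNzRingType) (A B : lmodType S) (f : {linear A -> B}).
Definition kpred : pred A := fun x => f x == 0.
Lemma kpred_submod : GRing.submod_closed kpred.
Proof.
split; first by rewrite /kpred unfold_in linear0.
by move=> a x y; rewrite !unfold_in /kpred => /eqP hx /eqP hy; rewrite linearP hx hy scaler0 addr0.
Qed.
HB.instance Definition _ := GRing.isSubmodClosed.Build S A kpred kpred_submod.
Record ker := Ker { kval : A; _ : kval \in kpred }.
HB.instance Definition _ := [isSub for kval].
HB.instance Definition _ := [Choice of ker by <:].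
HB.instance Definition _ := [SubChoice_isSubLmodule of ker by <:].

Lemma ker_ex : exists (K : lmodType S) (i : {linear K -> A}),
  injective i /\ forall x, f x = 0 <-> exists k, i k = x.
Proof.
exists ker, (val : {linear ker -> A}); split; first exact: val_inj.
move=> x; split=> [fx|[[k kP] <-]]; last by exact/eqP.
have kx : x \in kpred by rewrite unfold_in /kpred fx.
by exists (Ker kx).
Qed.
End Ker.

Section GP.
Variable S : comNzRingType.
Implicit Types A B C D G K M N P Q : lmodType S.

Lemma lift_inj A B D (i : {linear A -> B}) (t : {linear D -> B}) :
  injective i -> (forall x, exists y, i y = t x) ->
  exists s : {linear D -> A}, forall x, i (s x) = t x.
Proof.
move=> inj ex; apply: (lin_ex (R := fun x y => i y = t x)) => //.
- by move=> x y z <- /inj.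
- by move=> a x x' y y'; rewrite !linearP => -> ->.
Qed.

Lemma dd (T : tot_acyclic S) n x : td T (n + 1) (td T n x) = 0.
Proof. by apply/td_exact; exists x. Qed.

Lemma gp_emb G : gor_proj G -> exists Q C (j : {linear G -> Q})
  (c : {linear Q -> C}), [/\ fg_proj Q, gor_proj C & short_exact j c].
Proof.
move=> [T [n [j [ji jP]]]].
have [C [i [ii iP]]] := ker_ex (td T (n + 1)).
have [x|c Hc] := lift_inj (t := td T n) ii; first by apply/iP; exact: dd.
exists (T n), C, j, c; split; first exact: tc_proj.
  by exists T, (n + 1), i.
split=> //.
  move=> z; have [|y Hy] := proj1 (td_exact (t := T) (i z)).
    by apply/iP; exists z.
  by exists y; apply: ii; rewrite Hc.
move=> y; rewrite -jP -Hc; split=> [->|]; first by rewrite linear0.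
by rewrite -[X in _ = X](linear0 i) => /ii.
Qed.

Lemma gp_cov G : gor_proj G -> exists K A (i : {linear K -> A})
  (e : {linear A -> G}), [/\ fg_proj A, gor_proj K & short_exact i e].
Proof.
move=> [T [n [j [ji jP]]]].
have [m Em] : exists m, n = m + 1 by exists (n - 1); rewrite subrK.
subst n.
have [K [i [ii iP]]] := ker_ex (td T m).
have [x|e He] := lift_inj (t := td T m) ji; first by apply/jP; exact: dd.
exists K, (T m), i, e; split; first exact: tc_proj.
  by exists T, m, i.
split=> //.
  move=> z; have [|y Hy] := proj1 (td_exact (t := T) (j z)).
    by apply/jP; exists z.
  by exists y; apply: ji; rewrite He.
move=> y; rewrite -iP -He; split=> [->|]; first by rewrite linear0.
by rewrite -[X in _ = X](linear0 j) => /ji.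
Qed.

Lemma gp_fg G : gor_proj G -> fin_gen G.
Proof.
move=> /gp_cov[K [A [i [e [[fA _] _ [_ es _]]]]]].
exact: fin_gen_surj es fA.
Qed.

Lemma gp_ext A B C P (f : {linear A -> B}) (g : {linear B -> C}) :
  gor_proj C -> fg_proj P -> short_exact f g -> forall u : {linear A -> P},
  exists v : {linear B -> P}, forall x, v (f x) = u x.
Proof.
move=> [T [n [j [ji jP]]]] pP se u; have [fi gs ex] := se.
have [k Ek] : exists k, n = k + 1 + 1 + 1.
  by exists (n - 1 - 1 - 1); rewrite !subrK.
subst n.
have [x|e He] := lift_inj (t := td T (k + 1 + 1)) ji.
  by apply/jP; exact: dd.
have [l Hl] := proj2 (tc_proj T (k + 1 + 1)) _ _ g gs e.
have [x|s Hs] := short_exact_ker (t := l \o td T (k + 1)) se.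
  by rewrite /= Hl; apply: ji; rewrite He dd linear0.
have [y|v Hv] := td_coexact pP (n := k) (u := u \o s).
  have su : s (td T k y) = 0 by apply: fi; rewrite Hs /= dd !linear0.
  by rewrite /= su linear0.
have key a t : f a + l t = 0 -> u a + v t = 0.
  move=> h.
  have ga : g (f a) = 0 by apply/ex; exists a.
  have et : e t = 0 by rewrite -Hl; move: (congr1 g h); rewrite linearD ga add0r linear0.
  have [|r Hr] := proj1 (td_exact (t := T) t); first by rewrite -He et linear0.
  have ar : a + s r = 0 by apply: fi; rewrite linearD Hs /= Hr h linear0.
  by rewrite -Hr Hv /= -linearD ar linear0.
have [|||w Hw] := @lin_ex S B P
  (fun y z => exists a t, y = f a + l t /\ z = u a + v t).
- move=> y; have [t Ht] : exists t, e t = g y.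
    have [|t Ht] := proj1 (td_exact (t := T) (j (g y))).
      by apply/jP; exists (g y).
    by exists t; apply: ji; rewrite He.
  have [a Ha] : exists a, f a = y - l t.
    by apply/ex; rewrite linearB Hl Ht subrr.
  by exists (u a + v t), a, t; rewrite Ha subrK.
- move=> y z z' [a [t [Ey ->]]] [a' [t' [Ey' ->]]].
  apply/eqP; rewrite -subr_eq0 opprD addrACA -!linearB key //.
  by rewrite !linearB addrACA -opprD -Ey -Ey' subrr.
- move=> c y y' z z' [a [t [-> ->]]] [a' [t' [-> ->]]].
  by exists (c *: a + a'), (c *: t + t'); rewrite !linearP !scalerDr; split; exact: addrACA.
exists w => x; have [a [t [Ef ->]]] := Hw (f x).
apply/eqP; rewrite -subr_eq0 addrAC -linearB key //.
by rewrite linearB addrAC -Ef subrr.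
Qed.

Section Shift.
Variable T : tot_acyclic S.
Definition dc a b (e : a + 1 = b) : {linear T a -> T b} :=
  match e in _ = b return {linear T a -> T b} with erefl => td T a end.
Lemma dc_exact a b c (e1 : a + 1 = b) (e2 : b + 1 = c) (x : T b) :
  dc e2 x = 0 <-> exists y, dc e1 y = x.
Proof. by case: _ / e2; case: _ / e1 x => x; exact: td_exact. Qed.
Lemma dc_coexact Q : fg_proj Q -> forall a b c (e1 : a + 1 = b) (e2 : b + 1 = c)
  (u : {linear T b -> Q}), (forall y, u (dc e1 y) = 0) ->
  exists v : {linear T c -> Q}, forall x, v (dc e2 x) = u x.
Proof. by move=> pQ a b c e1 e2; case: _ / e2; case: _ / e1 => u; exact: td_coexact. Qed.
Lemma dc_ker a b (e : a + 1 = b) x : dc e x = 0 <-> td T a x = 0.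
Proof. by case: _ / e. Qed.
Lemma shE (k n : int) : n + k + 1 = n + 1 + k. Proof. by rewrite addrAC. Qed.
Definition sh k : tot_acyclic S :=
  @TotAcyclic S (fun n => T (n + k)) (fun n => dc (shE k n))
    (fun n => tc_proj T (n + k))
    (fun n x => dc_exact _ _ x)
    (fun Q pQ n u => @dc_coexact Q pQ _ _ _ _ _ u).
End Shift.

Section Prod.
Variables T U : tot_acyclic S.
Definition pd n : {linear (T n * U n)%type -> (T (n+1)%R * U (n+1)%R)%type} :=
  lpair (td T n \o fst : {linear _ -> _}) (td U n \o snd : {linear _ -> _}).
Lemma pd_exact n x : pd (n + 1) x = 0 <-> exists y, pd n y = x.
Proof.
case: x => a b; split=> [[/td_exact[x <-] /td_exact[y <-]]|[[x y] [<- <-]]].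
  by exists (x, y).
by congr pair; rewrite /= dd.
Qed.
Lemma pd_coexact Q : fg_proj Q -> forall n (u : {linear (T (n+1)%R * U (n+1)%R)%type -> Q}),
  (forall y, u (pd n y) = 0) ->
  exists v : {linear (T (n+1+1)%R * U (n+1+1)%R)%type -> Q}, forall x, v (pd (n+1) x) = u x.
Proof.
move=> pQ n u H.
have [y|v Hv] := td_coexact pQ (n := n) (u := u \o lpair idfun \0 : {linear T (n+1) -> Q}).
  by rewrite -[RHS](H (y, 0)) /=; congr (u _); congr pair; rewrite /= linear0.
have [y|v' Hv'] := td_coexact pQ (n := n) (u := u \o lpair \0 idfun : {linear U (n+1) -> Q}).
  by rewrite -[RHS](H (0, y)) /=; congr (u _); congr pair; rewrite /= linear0.
exists (lcopair v v') => -[x y]; rewrite /= Hv Hv' /= -linearD; congr (u _).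
by congr pair; rewrite /= ?addr0 ?add0r.
Qed.
Definition prodc : tot_acyclic S :=
  @TotAcyclic S _ pd (fun n => fg_proj_prod (tc_proj T n) (tc_proj U n)) pd_exact pd_coexact.
End Prod.

Lemma gp_prod M N : gor_proj M -> gor_proj N -> gor_proj (M * N)%type.
Proof.
move=> [T [n [j [ji jP]]]] [U [m [k [ki kP]]]].
have [d Ed] : exists d, m = n + d by exists (m - n); rewrite addrC subrK.
subst m.
exists (prodc T (sh U d)), n, (lpair (j \o fst : {linear _ -> _}) (k \o snd : {linear _ -> _})).
split; first by move=> [a b] [a' b'] [/ji -> /ki ->].
have E (a : T n) (b : U (n + d)) : td (prodc T (sh U d)) n (a, b) = (td T n a, @dc U _ _ (shE d n) b) by [].
have kP' x : @dc U _ _ (shE d n) x = 0 <-> exists g, k g = x.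
  exact: iff_trans (dc_ker _ _) (kP x).
move=> [a b]; rewrite E; split=> [[/jP[x <-] /kP'[y <-]]|[[x y] [<- <-]]].
  by exists (x, y).
by congr pair; [apply/jP; exists x|apply/kP'; exists y].
Qed.

Lemma fg_proj0 : fg_proj 'rV[S]_0.
Proof.
split.
  exists 0%N, (fun=> 0) => x; exists (fun=> 0).
  by rewrite big_ord0; apply/rowP => -[].
move=> A B p sur f; exists \0 => x /=.
have -> : x = 0 by apply/rowP => -[].
by rewrite !linear0.
Qed.

Lemma fgp_ext A B C P (f : {linear A -> B}) (g : {linear B -> C}) :
  fg_proj C -> fg_proj P -> short_exact f g -> forall u : {linear A -> P},
  exists v : {linear B -> P}, forall x, v (f x) = u x.
Proof.
by move=> /fg_proj_gor_proj; exact: gp_ext.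
Qed.

End GP.
End MonFrobenius.

(* The choices made in a Frobenius structure exist for both categories. *)
Section Existence.
Import MonFrobenius.
Variable S : comNzRingType.
Variable w : S.
Hypothesis w_reg : nonzerodivisor w.

Lemma MonG_frobenius : inhabited (frobenius (MonG w)).
Proof.
apply: Mon_frobenius => //.
- exact: fg_proj_gor_proj.
- exact: gp_fg.
- exact: gp_prod.
- exact: gp_emb.
- exact: gp_cov.
- exact: gp_ext.
Qed.

Lemma MonP_frobenius : inhabited (frobenius (MonP w)).
Proof.
apply: Mon_frobenius => //.
- by move=> M [].
- exact: fg_proj_prod.
- move=> G pG; exists G, 'rV[S]_0, idfun, \0; split=> //; first exact: fg_proj0.
  split=> //; first by move=> z; exists 0; apply/rowP => -[].
  by move=> y; split=> // _; exists y.
- move=> G pG; exists 'rV[S]_0, G, \0, idfun; split=> //; first exact: fg_proj0.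
  split=> //; first by move=> x y _; apply/rowP => -[].
    by move=> z; exists z.
  by move=> y; split=> [h|[x <-]] //; exists 0; symmetry; exact: h.
- exact: fgp_ext.
Qed.
End Existence.

(* Main.v *)
Require Import Defs.
From mathcomp Require Import all_boot all_order all_algebra.
From mathcomp Require Import boolp.

(* (1) A map of MonP factors through a projective iff it is "null-homotopic" for
   the pair (f, w f^-1), and null-homotopic maps factor through objects
   (A = A) + (B --w--> B), which are projective-injective in MonG too.  So the
   inclusion preserves injectives; as it preserves conflations, an injective hull
   in MonP is one in MonG, and a map that factors through a projective of MonG
   already factors through the injective hull of its source in MonP.
   (2) G --f--> P goes to the matrix factorization (f, w f^-1), and the same
   description of the maps factoring through projectives gives the equivalence
   with DB.
   In both cases the shift is compared through maps between conflations
   X -> I -> D with I injective, which are unique up to projectives, and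
   distinguished triangles through the corresponding pushouts: in (1) a pushout in
   MonG along a map into an object of MonP, in (2) the mapping cone, the pushout of
   the explicit hull X -> (X0 = X0) + (X1 --w--> X1) -> shift X. *)

Set Implicit Arguments.
Unset Strict Implicit.
Unset Printing Implicit Defensive.

Import GRing.Theory.
Import MonFrobenius.
Local Open Scope ring_scope.

(** * Isomorphisms of triangles and their images under functors *)

Section TriangleIsomorphisms.
Local Open Scope cat_scope.

Lemma is_iso_id (C : precat) (X : C) : is_iso (idm X).
Proof. by exists (idm X); rewrite ccomp1m; split; exact: hrefl. Qed.

Lemma is_iso_comp (C : precat) (X Y Z : C) (g : arrow Y Z) (f : arrow X Y) :
  is_iso g -> is_iso f -> is_iso (g ∘ f).
Proof.
move=> [g' [g'g gg']] [f' [f'f ff']]; exists (f' ∘ g'); split.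
  by rewrite -ccompA (ccompA g') g'g ccomp1m f'f; exact: hrefl.
by rewrite -ccompA (ccompA f) ff' ccomp1m gg'; exact: hrefl.
Qed.

Lemma is_iso_fmap (C D : precat) (F : functor C D) (X Y : C) (f : arrow X Y) :
  is_iso f -> is_iso (fmap F f).
Proof.
by move=> [g [gf fg]]; exists (fmap F g); rewrite -!fmapM gf fg !fmap1; split;
  exact: hrefl.
Qed.

Lemma tri_iso_trans (C : precat) (T : functor C C) (X Y Z X' Y' Z' X2 Y2 Z2 : C)
    (u : arrow X Y) (v : arrow Y Z) (w : arrow Z (T X))
    (u' : arrow X' Y') (v' : arrow Y' Z') (w' : arrow Z' (T X'))
    (u2 : arrow X2 Y2) (v2 : arrow Y2 Z2) (w2 : arrow Z2 (T X2)) :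
  tri_iso u v w u' v' w' -> tri_iso u' v' w' u2 v2 w2 -> tri_iso u v w u2 v2 w2.
Proof.
move=> [a [b [c [[ia ib ic] [bu cv aw]]]]] [a' [b' [c' [[ia' ib' ic'] [bu' cv' aw']]]]].
exists (a' ∘ a), (b' ∘ b), (c' ∘ c); split; split; try exact: is_iso_comp.
- by rewrite -ccompA bu ccompA bu' ccompA; exact: hrefl.
- by rewrite -ccompA cv ccompA cv' ccompA; exact: hrefl.
- by rewrite fmapM -ccompA aw ccompA aw' ccompA; exact: hrefl.
Qed.

Lemma tri_iso_map (C D : precat) (T : functor C C) (T' : functor D D)
    (F : functor C D) (theta : forall X : C, arrow (F (T X)) (T' (F X)))
    (X Y Z X' Y' Z' : C)
    (u : arrow X Y) (v : arrow Y Z) (w : arrow Z (T X))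
    (u' : arrow X' Y') (v' : arrow Y' Z') (w' : arrow Z' (T X')) :
  @nat_iso C D (fcomp F T) (fcomp T' F) theta -> tri_iso u v w u' v' w' ->
  @tri_iso D T' _ _ _ _ _ _ (fmap F u) (fmap F v) (theta X ∘ fmap F w)
    (fmap F u') (fmap F v') (theta X' ∘ fmap F w').
Proof.
move=> [_ nat] [a [b [c [[ia ib ic] [bu cv aw]]]]].
exists (fmap F a), (fmap F b), (fmap F c); split; split; try exact: is_iso_fmap.
- by rewrite -!fmapM bu; exact: hrefl.
- by rewrite -!fmapM cv; exact: hrefl.
- have /= := nat _ _ a; rewrite ccompA => <-.
  by rewrite -!ccompA -!fmapM aw; exact: hrefl.
Qed.

End TriangleIsomorphisms.

(** * Maps of conflations with injective middle term, modulo projectives *)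

Section StableCategory.
Local Open Scope cat_scope.
Variables (E : excat) (T : frobenius E).

Lemma conf_map_ex (X X' I I' D D' : E) (i : arrow X I) (p : arrow I D)
    (i' : arrow X' I') (p' : arrow I' D') (f : arrow X X') :
  conf i p -> conf i' p' -> injective_obj I' ->
  exists h g, h ∘ i ≈ i' ∘ f /\ g ∘ p ≈ p' ∘ h.
Proof.
move=> cf cf' inj; have [h Hh] := inj _ _ _ _ _ cf (i' ∘ f).
have [_ H] := conf_cokernel cf; have [K _] := conf_cokernel cf'.
have [|g [Hg _]] := H _ (p' ∘ h); last by exists h, g.
by rewrite -ccompA Hh ccompA K ccomp0m; exact: hrefl.
Qed.

(** The difference [h ⊖ h'] kills [i], so it is [t ∘ p] for some [t]; cancelling the epimorphism [p]
    gives [g ⊖ g' ≈ p' ∘ t], which passes through [I']. *)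
Lemma conf_map_uniq (X I I' D D' : E) (i : arrow X I) (p : arrow I D)
    (p' : arrow I' D') (h h' : arrow I I') (g g' : arrow D D') :
  conf i p -> injective_obj I' -> h ∘ i ≈ h' ∘ i ->
  g ∘ p ≈ p' ∘ h -> g' ∘ p ≈ p' ∘ h' -> thru_proj (g ⊖ g').
Proof.
move=> cf inj hh' gp g'p; have [_ H] := conf_cokernel cf.
have [|t [Ht _]] := H _ (h ⊖ h').
  by rewrite ccompDl ccompNm hh' haddNr; exact: hrefl.
exists I', p', t; split; first exact/(fr_proj_inj T).
apply: conf_epi cf _; rewrite -ccompA Ht ccompDl ccompDr ccompNm ccompmN gp g'p.
exact: hrefl.
Qed.

(** The identity of [X] also extends backwards; both composites extend the identity, so
    [conf_map_uniq] compares them with it. *)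
Lemma conf_map_iso (X I I' D D' : E) (i : arrow X I) (p : arrow I D)
    (i' : arrow X I') (p' : arrow I' D') (h : arrow I I') (g : arrow D D') :
  conf i p -> conf i' p' -> injective_obj I -> injective_obj I' ->
  h ∘ i ≈ i' -> g ∘ p ≈ p' ∘ h -> @is_iso (stable T) D D' g.
Proof.
move=> cf cf' inj inj' hi gp.
have [h' [g' [h'i g'p]]] := conf_map_ex (idm X) cf' cf inj.
exists g'; split.
  refine (@conf_map_uniq X I I D D i p p (h' ∘ h) (idm I) (g' ∘ g) (idm D) cf inj _ _ _).
  - by rewrite -ccompA hi h'i ccomp1m ccompm1; exact: hrefl.
  - by rewrite -ccompA gp !ccompA g'p; exact: hrefl.
  - by rewrite ccomp1m ccompm1; exact: hrefl.
refine (@conf_map_uniq X I' I' D' D' i' p' p' (h ∘ h') (idm I') (g ∘ g') (idm D') cf' inj' _ _ _).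
- by rewrite -ccompA h'i ccompA hi ccomp1m ccompm1; exact: hrefl.
- by rewrite -ccompA g'p !ccompA gp; exact: hrefl.
- by rewrite ccomp1m ccompm1; exact: hrefl.
Qed.

Lemma stable_dist_iso (X Y Z X' Y' Z' : stable T)
    (u : arrow X Y) (v : arrow Y Z) (w : arrow Z (shift X))
    (u' : arrow X' Y') (v' : arrow Y' Z') (w' : arrow Z' (shift X')) :
  tri_iso u v w u' v' w' -> dist u' v' w' -> dist u v w.
Proof.
move=> H [X2 [Y2 [Z2 [u2 [v2 [w2 [std K]]]]]]]; exists X2, Y2, Z2, u2, v2, w2.
by split=> //; exact: tri_iso_trans H K.
Qed.

(** Distinguished triangles are the isomorphic copies of standard ones, and [tri_iso_map] transports
    the isomorphisms; this reduces the verification to standard triangles. *)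
Lemma triangle_functorI (D : tricat) (F : functor (stable T) D)
    (theta : forall X : stable T, arrow (F (shift X)) (shift (F X))) :
  @nat_iso (stable T) D (fcomp F shift) (fcomp shift F) theta ->
  (forall (X Y Z X' Y' Z' : D) (u : arrow X Y) (v : arrow Y Z)
      (w : arrow Z (shift X)) (u' : arrow X' Y') (v' : arrow Y' Z')
      (w' : arrow Z' (shift X')),
    tri_iso u v w u' v' w' -> dist u' v' w' -> dist u v w) ->
  (forall (X Y Z : stable T) (u : arrow X Y) (v : arrow Y Z)
      (w : arrow Z (shift X)), @standard_triangle E T X Y Z u v w ->
    dist (fmap F u) (fmap F v) (theta X ∘ fmap F w)) ->
  triangle_functor theta.
Proof.
move=> nat closed std; split=> // X Y Z u v w.
move=> [X' [Y' [Z' [u' [v' [w' [H K]]]]]]].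
exact: closed (tri_iso_map nat K) (std _ _ _ _ _ _ H).
Qed.

End StableCategory.

(** * Pushout squares arising from two conflations with the same cokernel *)

Section Pushout.
Variables (S : comNzRingType) (A I D Y Z : lmodType S).
Variables (i : {linear A -> I}) (p : {linear I -> D}).
Variables (u : {linear A -> Y}) (v : {linear Y -> Z}) (q : {linear Z -> D}).
Variable k : {linear I -> Z}.
Hypotheses (ip : short_exact i p) (vq : short_exact v q).
Hypotheses (ki : forall x, k (i x) = v (u x)) (qk : forall x, q (k x) = p x).

Lemma pushout_gen z : exists y x, z = v y + k x.
Proof.
have [_ ps _] := ip; have [_ _ vex] := vq.
have [x px] := ps (q z).
have [|y vy] := proj1 (vex (z - k x)); first by rewrite linearB qk px subrr.
by exists y, x; rewrite vy subrK.
Qed.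

(** By [pushout_gen], [(v, k)] maps the sum of [Y] and [I] onto [Z]. Its kernel consists of the
    pairs [(u (- s), i s)], on which [a + b] vanishes, so [a + b] descends. *)
Lemma pushout_desc (W : lmodType S) (a : {linear Y -> W}) (b : {linear I -> W}) :
  (forall x, a (u x) = b (i x)) ->
  exists c : {linear Z -> W}, (forall y, c (v y) = a y) /\ (forall x, c (k x) = b x).
Proof.
move=> ab; have [_ _ pex] := ip; have [vi _ vex] := vq.
have key y x : v y + k x = 0 -> a y + b x = 0.
  move=> h; have [|s Hs] := proj1 (pex x).
    move: (congr1 q h); rewrite linearD qk linear0.
    by have -> : q (v y) = 0 by [apply/vex; exists y]; rewrite add0r.
  have <- : u (- s) = y.
    by apply: vi; rewrite -ki !linearN Hs; apply/esym/eqP; rewrite -addr_eq0 h.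
  by rewrite ab -Hs !linearN addNr.
(* [c] is given by its graph; [key] makes it single-valued. *)
have [|||c Hc] := @lin_ex S Z W (fun z t => exists y x, z = v y + k x /\ t = a y + b x).
- by move=> z; have [y [x ->]] := pushout_gen z; exists (a y + b x), y, x.
- move=> z t t' [y [x [-> ->]]] [y' [x' [e ->]]].
  apply/eqP; rewrite -subr_eq0 opprD addrACA -!linearB key //.
  by rewrite !linearB addrACA -opprD -e subrr.
- move=> s z z' t t' [y [x [-> ->]]] [y' [x' [-> ->]]].
  by exists (s *: y + y'), (s *: x + x'); rewrite !linearP !scalerDr; split; exact: addrACA.
have cE y x : c (v y + k x) = a y + b x.
  have [y' [x' [e ->]]] := Hc (v y + k x).
  apply/eqP; rewrite -subr_eq0 opprD addrACA -!linearB key //.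
  by rewrite !linearB addrACA -opprD -e subrr.
exists c; split=> [y|x]; first by rewrite -[v y]addr0 -(linear0 k) cE linear0 addr0.
by rewrite -[k x]add0r -(linear0 v) cE linear0 add0r.
Qed.
End Pushout.

(** Uniqueness takes the form that [v] and [k] are jointly epimorphic, so that it can be used apart
    from existence. *)
Definition is_pushout (C : precat) (A I Y Z : C) (i : arrow A I) (u : arrow A Y)
    (k : arrow I Z) (v : arrow Y Z) :=
  [/\ (k ∘ i ≈ v ∘ u)%cat,
      forall (W : C) (a : arrow Y W) (b : arrow I W), (a ∘ u ≈ b ∘ i)%cat ->
        exists c : arrow Z W, (c ∘ v ≈ a)%cat /\ (c ∘ k ≈ b)%cat
    & forall (W : C) (s s' : arrow Z W), (s ∘ v ≈ s' ∘ v)%cat ->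
        (s ∘ k ≈ s' ∘ k)%cat -> (s ≈ s')%cat].

Section MonPushout.
Local Open Scope cat_scope.
Variables (S : comNzRingType) (w : S) (X : lmodType S -> Prop).

(** Both components are pushouts of modules; the two descended maps commute with the structure maps
    because they do so on the elements [v y + k x]. *)
Lemma mor_pushout (A I D Y Z : MorEx S) (i : arrow A I) (p : arrow I D)
    (u : arrow A Y) (v : arrow Y Z) (q : arrow Z D) (k : arrow I Z) :
  conf i p -> conf v q -> k ∘ i ≈ v ∘ u -> q ∘ k ≈ p -> is_pushout i u k v.
Proof.
move=> [ip1 ip0] [vq1 vq0] ki [qk1 qk0]; split=> // [W a b [ab1 ab0]|W s s' [sv1 sv0] [sk1 sk0]].
  have [ki1 ki0] := ki.
  have [c1 [cv1 ck1]] := pushout_desc ip1 vq1 ki1 qk1 ab1.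
  have [c0 [cv0 ck0]] := pushout_desc ip0 vq0 ki0 qk0 ab0.
  have com z : c0 (Z z) = W (c1 z).
    have [y [x ->]] := pushout_gen ip1 vq1 qk1 z.
    by rewrite !linearD -!hom_comm cv0 ck0 cv1 ck1 !hom_comm.
  by exists (MorHom com).
split=> z.
  have [y [x ->]] := pushout_gen ip1 vq1 qk1 z.
  by rewrite !linearD [hom1 s _]sv1 [hom1 s _]sk1.
have [y [x ->]] := pushout_gen ip0 vq0 qk0 z.
by rewrite !linearD [hom0 s _]sv0 [hom0 s _]sk0.
Qed.

Lemma mon_pushout (A I D Y Z : Mon w X) (i : arrow A I) (p : arrow I D)
    (u : arrow A Y) (v : arrow Y Z) (q : arrow Z D) (k : arrow I Z) :
  conf i p -> conf v q -> k ∘ i ≈ v ∘ u -> q ∘ k ≈ p -> is_pushout i u k v.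
Proof.
move=> ip vq ki qk.
have [_ H K] := @mor_pushout (sval A) (sval I) (sval D) (sval Y) (sval Z) i p u v q k ip vq ki qk.
by split=> // W; [exact: H|exact: K].
Qed.
End MonPushout.

(** * Independence of the cone from the hull along which it is formed *)

Section Comparison.
Local Open Scope cat_scope.
Variables (E : excat) (T : frobenius E).

Lemma pushout_map_ex (A Y I I' D D' Z Z' : E) (u : arrow A Y)
    (i : arrow A I) (p : arrow I D) (v : arrow Y Z) (q : arrow Z D) (k : arrow I Z)
    (i' : arrow A I') (p' : arrow I' D') (v' : arrow Y Z') (q' : arrow Z' D')
    (k' : arrow I' Z') (h : arrow I I') (g : arrow D D') :
  is_pushout i u k v -> conf v q -> q ∘ k ≈ p ->
  is_pushout i' u k' v' -> conf v' q' -> q' ∘ k' ≈ p' ->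
  h ∘ i ≈ i' -> g ∘ p ≈ p' ∘ h ->
  exists c : arrow Z Z', [/\ c ∘ v ≈ v', c ∘ k ≈ k' ∘ h & q' ∘ c ≈ g ∘ q].
Proof.
move=> [ki desc epi] vq qk [ki' _ _] vq' qk' hi gp.
have [|c [cv ck]] := desc Z' v' (k' ∘ h).
  by rewrite -ki' -ccompA hi; exact: hrefl.
exists c; split=> //; have [qv _] := conf_kernel vq; have [qv' _] := conf_kernel vq'.
apply: epi.
  by rewrite -!ccompA cv qv' qv ccompm0; exact: hrefl.
by rewrite -!ccompA ck qk gp ccompA qk'; exact: hrefl.
Qed.

(** Since [r ⊖ idm I] kills [i], it equals [t ∘ p]. Then [c ⊖ idm Z] is [k ∘ t ∘ q]: both vanish on
    [v], and both give [k ∘ t ∘ p] on [k]. *)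
Lemma pushout_endo_stable (A Y I D Z : E) (u : arrow A Y) (i : arrow A I)
    (p : arrow I D) (v : arrow Y Z) (q : arrow Z D) (k : arrow I Z)
    (r : arrow I I) (c : arrow Z Z) :
  conf i p -> is_pushout i u k v -> conf v q -> q ∘ k ≈ p -> injective_obj I ->
  r ∘ i ≈ i -> c ∘ v ≈ v -> c ∘ k ≈ k ∘ r -> thru_proj (c ⊖ idm Z).
Proof.
move=> ip [_ _ epi] vq qk inj ri cv ck.
have [_ H] := conf_cokernel ip.
have [|t [Ht _]] := H _ (r ⊖ idm I).
  by rewrite ccompDl ccompNm ri ccomp1m haddNr; exact: hrefl.
have [qv _] := conf_kernel vq.
exists I, k, (t ∘ q); split; first exact/(fr_proj_inj T).
apply: epi.
  by rewrite -!ccompA qv !ccompm0 ccompDl ccompNm cv ccomp1m haddNr; exact: hrefl.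
rewrite -!ccompA qk Ht ccompDl ccompDr ccompNm ccompmN ck ccomp1m ccompm1.
exact: hrefl.
Qed.

(** Each hull maps to the other over the identity of [A], inducing maps of pushouts both ways; their
    composites fix [Y] and are stably identities by [pushout_endo_stable]. *)
Lemma pushout_map_iso (A Y I I' D D' Z Z' : E) (u : arrow A Y)
    (i : arrow A I) (p : arrow I D) (v : arrow Y Z) (q : arrow Z D) (k : arrow I Z)
    (i' : arrow A I') (p' : arrow I' D') (v' : arrow Y Z') (q' : arrow Z' D')
    (k' : arrow I' Z') (h : arrow I I') (g : arrow D D') :
  conf i p -> is_pushout i u k v -> conf v q -> q ∘ k ≈ p -> injective_obj I ->
  conf i' p' -> is_pushout i' u k' v' -> conf v' q' -> q' ∘ k' ≈ p' ->
  injective_obj I' -> h ∘ i ≈ i' -> g ∘ p ≈ p' ∘ h ->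
  exists c : arrow Z Z',
    [/\ @is_iso (stable T) Z Z' c, c ∘ v ≈ v' & q' ∘ c ≈ g ∘ q].
Proof.
move=> ip po vq qk inj ip' po' vq' qk' inj' hi gp.
have [c [cv ck qc]] := pushout_map_ex po vq qk po' vq' qk' hi gp.
have [h' [g' [h'i gp']]] := conf_map_ex (idm A) ip' ip inj.
rewrite ccompm1 in h'i.
have [c' [cv' ck' _]] := pushout_map_ex po' vq' qk' po vq qk h'i gp'.
exists c; split=> //; exists c'; split.
  refine (@pushout_endo_stable A Y I D Z u i p v q k (h' ∘ h) (c' ∘ c) ip po vq qk inj _ _ _).
  - by rewrite -ccompA hi h'i; exact: hrefl.
  - by rewrite -ccompA cv cv'; exact: hrefl.
  - by rewrite -ccompA ck !ccompA ck'; exact: hrefl.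
refine (@pushout_endo_stable A Y I' D' Z' u i' p' v' q' k' (h ∘ h') (c ∘ c') ip' po' vq' qk' inj' _ _ _).
- by rewrite -ccompA h'i hi; exact: hrefl.
- by rewrite -ccompA cv' cv; exact: hrefl.
- by rewrite -ccompA ck' !ccompA ck; exact: hrefl.
Qed.
End Comparison.

(** * Systems of injective hulls and the comparison of their cokernels *)

Section Hulls.
Local Open Scope cat_scope.
Variables (C : precat) (E : excat) (T : frobenius E) (F : functor C E).

(* The map [hull_cokm f] between the cokernels of the hulls is only required to
   be induced by [f]; it is determined by [f] up to maps factoring through
   projectives, so it need not be functorial on the nose. *)
Record hull_system := HullSystem {
  hull_obj : C -> E;
  hull_cok : C -> E;
  hull_i : forall X, arrow (F X) (hull_obj X);
  hull_p : forall X, arrow (hull_obj X) (hull_cok X);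
  hull_ip : forall X, conf (hull_i X) (hull_p X);
  hull_inj : forall X, injective_obj (hull_obj X);
  hull_cokm : forall X Y : C, arrow X Y -> arrow (hull_cok X) (hull_cok Y);
  hull_cokmP : forall (X Y : C) (f : arrow X Y), exists r,
    r ∘ hull_i X ≈ hull_i Y ∘ fmap F f /\ hull_cokm f ∘ hull_p X ≈ hull_p Y ∘ r
}.

(** The identity of [F X] induces [g X]. Naturality holds modulo projectives because both ways
    around the square are induced by extensions of the same map out of [F X]. This provides the
    shift isomorphisms of both parts. *)
Lemma hull_comparison (H K : hull_system) :
  exists g : forall X, arrow (hull_cok H X) (hull_cok K X),
    [/\ forall X, exists2 h, h ∘ hull_i H X ≈ hull_i K X
                           & g X ∘ hull_p H X ≈ hull_p K X ∘ h,
        forall X, @is_iso (stable T) _ _ (g X)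
      & forall (X Y : C) (f : arrow X Y),
          thru_proj ((g Y ∘ hull_cokm H f) ⊖ (hull_cokm K f ∘ g X))].
Proof.
have ex X : exists g : arrow (hull_cok H X) (hull_cok K X),
    exists2 h, h ∘ hull_i H X ≈ hull_i K X & g ∘ hull_p H X ≈ hull_p K X ∘ h.
  have [h [g [hi gp]]] :=
    conf_map_ex (idm (F X)) (hull_ip H X) (hull_ip K X) (@hull_inj K X).
  by exists g, h; rewrite // hi ccompm1; exact: hrefl.
exists (fun X => projT1 (cid (ex X))).
have gP X := projT2 (cid (ex X)); split=> // [X|X Y f].
  have [h hi gp] := gP X.
  exact: (conf_map_iso T (hull_ip H X) (hull_ip K X) (@hull_inj H X)
    (@hull_inj K X) hi gp).
have [h hi gp] := gP X; have [k ki gk] := gP Y.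
have [r [ri rp]] := hull_cokmP H f; have [s [si sp]] := hull_cokmP K f.
refine (@conf_map_uniq _ T _ _ _ _ _ _ _ (hull_p K Y) (k ∘ r) (s ∘ h) _ _
  (hull_ip H X) (@hull_inj K Y) _ _ _).
- by rewrite -ccompA ri ccompA ki -ccompA hi si; exact: hrefl.
- by rewrite -ccompA rp !ccompA gk; exact: hrefl.
- by rewrite -ccompA gp !ccompA sp; exact: hrefl.
Qed.
End Hulls.

Definition frobenius_hulls (C : precat) (E : excat) (T : frobenius E)
    (F : functor C E) : hull_system F :=
  @HullSystem C E F (fun X => fr_inj T (F X)) (fun X => cosyz T (F X))
    (fun X => fr_iota T (F X)) (fun X => fr_pi T (F X)) (fun X => fr_conf T (F X))
    (fun X => @fr_injP E T (F X)) (fun X Y f => cosyz_map T (fmap F f))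
    (fun X Y f => cosyz_mapP T (fmap F f)).

(** * Functors induced on quotients by ideals *)

Section QuotientFunctor.
Local Open Scope cat_scope.
Variables (C D : precat) (N : ideal C) (N' : ideal D).

Lemma fmapB (F : functor C D) (X Y : C) (f g : arrow X Y) :
  fmap F (f ⊖ g) ≈ fmap F f ⊖ fmap F g.
Proof.
rewrite fmapD; apply: hadd_heq; first exact: hrefl.
apply: hopp_uniq; rewrite -fmapD haddN; apply: hadd_idem0.
by rewrite -fmapD hadd0; exact: hrefl.
Qed.

Definition quo_functor (F : functor C D)
  (FN : forall (X Y : C) (f : arrow X Y), N _ _ f -> N' _ _ (fmap F f)) :
  functor (quocat N) (quocat N').
Proof.
refine (@Functor (quocat N) (quocat N') F (fun X Y f => fmap F f) _ _ _ _).
- move=> X Y f g H; apply: (inI_heq _ (FN _ _ _ H)); exact: fmapB.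
- by move=> X; apply: quot_of_heq; exact: fmap1.
- by move=> X Y Z g f; apply: quot_of_heq; exact: fmapM.
- by move=> X Y f g; apply: quot_of_heq; exact: fmapD.
Defined.

Lemma quo_is_iso (X Y : C) (f : arrow X Y) : is_iso f -> @is_iso (quocat N) X Y f.
Proof. by move=> [g [gf fg]]; exists g; split; exact: quot_of_heq. Qed.
End QuotientFunctor.

Lemma quo_nat_iso_id (C D : precat) (N : ideal C) (N' : ideal D)
  (F : functor C D) (G : functor D C) FN GN (t : forall X, arrow (G (F X)) X) :
  @nat_iso _ _ (fcomp G F) (fid C) t ->
  @nat_iso (quocat N) (quocat N)
    (fcomp (@quo_functor D C N' N G GN) (@quo_functor C D N N' F FN)) (fid _) t.
Proof.
move=> [ti tn]; split=> [X|X Y f]; first exact: (quo_is_iso N (ti X)).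
by apply: quot_of_heq; exact: tn.
Qed.

(** * Fully faithful exact functors that preserve injectives *)

Section StableExactFunctor.
Local Open Scope cat_scope.
Variables (E E' : excat) (T : frobenius E) (T' : frobenius E') (F : functor E E').
Hypothesis F_ff : fully_faithful F.
Hypothesis F_conf : forall (X Y Z : E) (i : arrow X Y) (p : arrow Y Z),
  conf i p -> conf (fmap F i) (fmap F p).
Hypothesis F_inj : forall I : E, injective_obj I -> injective_obj (F I).
Hypothesis pushoutP : forall (A I D Y Z : E') (i : arrow A I) (p : arrow I D)
    (u : arrow A Y) (v : arrow Y Z) (q : arrow Z D) (k : arrow I Z),
  conf i p -> conf v q -> k ∘ i ≈ v ∘ u -> q ∘ k ≈ p -> is_pushout i u k v.
Hypothesis pushout_ex : forall (Y : E) (A I D : E') (i : arrow A I) (p : arrow I D)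
    (u : arrow A (F Y)), conf i p ->
  exists Z (v : arrow (F Y) Z) (q : arrow Z D) (k : arrow I Z),
    [/\ conf v q, k ∘ i ≈ v ∘ u & q ∘ k ≈ p].

Lemma fmap_thru_proj (X Y : E) (f : arrow X Y) : thru_proj f -> thru_proj (fmap F f).
Proof.
move=> [P [b [a [pP e]]]]; exists (F P), (fmap F b), (fmap F a); split.
  by apply/(fr_proj_inj T'); apply: F_inj; apply/(fr_proj_inj T).
by rewrite e fmapM; exact: hrefl.
Qed.

(** [P] is injective, so [a] extends over the image of the hull of [X]; fullness lifts the resulting
    map from that hull, and faithfulness lifts the factorization. *)
Lemma thru_proj_fmap (X Y : E) (f : arrow X Y) : thru_proj (fmap F f) -> thru_proj f.
Proof.
move=> [P [b [a [pP e]]]].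
have [a' Ha] := proj1 (fr_proj_inj T' P) pP _ _ _ _ _ (F_conf (fr_conf T X)) a.
have [m Hm] := proj2 F_ff _ _ (b ∘ a').
exists (fr_inj T X), m, (fr_iota T X); split.
  by apply/(fr_proj_inj T); exact: fr_injP.
apply: (proj1 F_ff); rewrite fmapM Hm -ccompA Ha; exact: e.
Qed.

Lemma exact_stably_defined : stably_defined T T' F.
Proof.
move=> X Y f g /fmap_thru_proj H.
exact: (@inI_heq E' (thru_proj_ideal T') _ _ _ (fmap F f ⊖ fmap F g) (fmapB F f g) H).
Qed.

Lemma exact_stable_fully_faithful : fully_faithful (stable_functor exact_stably_defined).
Proof.
split=> [X Y f g H|X Y h].
  apply: thru_proj_fmap.
  exact: (@inI_heq E' (thru_proj_ideal T') _ _ _ _ (hsym (fmapB F f g)) H).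
have [f Hf] := proj2 F_ff _ _ h; exists f; exact: quot_of_heq.
Qed.

Lemma fmap_cosyz (X Y : E) (f : arrow X Y) : exists r,
  r ∘ fmap F (fr_iota T X) ≈ fmap F (fr_iota T Y) ∘ fmap F f /\
  fmap F (cosyz_map T f) ∘ fmap F (fr_pi T X) ≈ fmap F (fr_pi T Y) ∘ r.
Proof.
have [r [ri rp]] := cosyz_mapP T f; exists (fmap F r).
by rewrite -!fmapM ri rp; split; exact: hrefl.
Qed.

(** The cosyzygies of the source, seen in the target; comparing them with [frobenius_hulls] compares
    [F (shift X)] with [shift (F X)]. *)
Definition image_hulls : hull_system F :=
  @HullSystem E E' F (fun X => F (fr_inj T X)) (fun X => F (cosyz T X))
    (fun X => fmap F (fr_iota T X)) (fun X => fmap F (fr_pi T X))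
    (fun X => F_conf (fr_conf T X)) (fun X => F_inj (@fr_injP _ T X))
    (fun X Y f => fmap F (cosyz_map T f)) fmap_cosyz.

(** [F] sends a standard triangle to a pushout along the image of the hull of [X], whereas a
    standard triangle on [fmap F u] is a pushout along the hull of [F X]. [pushout_map_iso]
    identifies the two cones. *)
Lemma exact_stable_triangle :
  exists (H : stably_defined T T' F)
         (theta : forall X : stable T,
            arrow (stable_functor H (shift X)) (shift (stable_functor H X))),
    triangle_functor theta /\ fully_faithful (stable_functor H).
Proof.
have [g [gP gi gn]] := hull_comparison T' image_hulls (frobenius_hulls T' F).
exists exact_stably_defined, g; split; last exact: exact_stable_fully_faithful.
apply: triangle_functorI => //; first exact: (@stable_dist_iso E' T').
move=> X Y Z u v q [vq [k [ki qk]]]; have [h hi gp] := gP X.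
have [Z' [v' [q' [k' [vq' ki' qk']]]]] := pushout_ex (fmap F u) (fr_conf T' (F X)).
have Fki : fmap F k ∘ fmap F (fr_iota T X) ≈ fmap F v ∘ fmap F u.
  by rewrite -!fmapM ki; exact: hrefl.
have Fqk : fmap F q ∘ fmap F k ≈ fmap F (fr_pi T X) by rewrite -fmapM qk; exact: hrefl.
have po := pushoutP (F_conf (fr_conf T X)) (F_conf vq) Fki Fqk.
have po' := pushoutP (fr_conf T' (F X)) vq' ki' qk'.
have [c [ic cv qc]] := pushout_map_iso T' (F_conf (fr_conf T X)) po (F_conf vq) Fqk
  (F_inj (@fr_injP _ T X)) (fr_conf T' (F X)) po' vq' qk' (@fr_injP _ T' (F X)) hi gp.
exists (F X), (F Y), Z', (fmap F u), v', q'; split; first by split=> //; exists k'.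
exists (idm (F X)), (idm (F Y)), c; split; split.
- exact: (@is_iso_id (stable T')).
- exact: (@is_iso_id (stable T')).
- exact: ic.
- exact: htrans (ccomp1m _) (hsym (ccompm1 _)).
- by apply: htrans (hsym (ccompm1 _)); exact: quot_of_heq cv.
- apply: htrans (ccomp_heq (fmap1 _ _) (hrefl _)) (htrans (ccomp1m _) _).
  exact: quot_of_heq (hsym qc).
Qed.
End StableExactFunctor.

(** * Triangle functors from a stable category to a quotient category, tested on one system of
    hulls *)

Section StableToQuotient.
Local Open Scope cat_scope.
Variables (E : excat) (T : frobenius E) (P : precat) (N : ideal P) (F : functor E P).
Hypothesis FN : forall (X Y : E) (f : arrow X Y), thru_proj f -> N _ _ (fmap F f).
Local Notation SF := (@quo_functor E P (thru_proj_ideal T) N F FN).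

Variable Sh : functor (quocat N) (quocat N).
Variable ds : forall X Y Z : quocat N, arrow X Y -> arrow Y Z -> arrow Z (Sh X) -> Prop.
Local Notation D := (@Tricat (quocat N) Sh ds).
Hypothesis dsI : forall (X Y Z X' Y' Z' : D) (u : arrow X Y) (v : arrow Y Z)
    (q : arrow Z (shift X)) (u' : arrow X' Y') (v' : arrow Y' Z')
    (q' : arrow Z' (shift X')),
  tri_iso u v q u' v' q' -> dist u' v' q' -> dist u v q.

Variable K : hull_system (fid E).
Variable sK : forall X : E, @arrow (quocat N) (F (hull_cok K X)) (Sh (F X)).
Hypothesis sK_iso : forall X, @is_iso (quocat N) _ _ (sK X).
Hypothesis sK_nat : forall (X Y : E) (f : arrow X Y),
  @heq (quocat N) _ _ (@ccomp (quocat N) _ _ _ (sK Y) (fmap F (hull_cokm K f)))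
    (@ccomp (quocat N) _ _ _ (@fmap (quocat N) _ Sh (F X) (F Y) (fmap F f)) (sK X)).
Hypothesis pushoutP : forall (A I D Y Z : E) (i : arrow A I) (p : arrow I D)
    (u : arrow A Y) (v : arrow Y Z) (q : arrow Z D) (k : arrow I Z),
  conf i p -> conf v q -> k ∘ i ≈ v ∘ u -> q ∘ k ≈ p -> is_pushout i u k v.
Hypothesis cone_ex : forall (X Y : E) (u : arrow X Y),
  exists Z (v : arrow Y Z) (q : arrow Z (hull_cok K X)) (k : arrow (hull_obj K X) Z),
    [/\ conf v q, k ∘ hull_i K X ≈ v ∘ u, q ∘ k ≈ hull_p K X
      & @dist D (F X) (F Y) (F Z) (fmap F u) (fmap F v)
          (@ccomp (quocat N) _ _ _ (sK X) (fmap F q))].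

(** The isomorphism [theta] first passes from the chosen cosyzygy to the cokernel of the hull in
    [K], then applies [sK]. A standard triangle is compared in the same way with the cone over the
    hull in [K], distinguished by [cone_ex]. *)
Lemma stable_to_quotient_triangle :
  exists theta : forall X : stable T, @arrow D (SF (shift X)) (Sh (SF X)),
    @triangle_functor (stable T) D SF theta.
Proof.
have [g [gP gi gn]] := hull_comparison T (frobenius_hulls T (fid E)) K.
exists (fun X => @ccomp (quocat N) _ _ _ (sK X) (fmap F (g X))).
apply: triangle_functorI => //.
  split=> [X|X Y f].
    by apply: (@is_iso_comp (quocat N)); [exact: sK_iso|exact: (is_iso_fmap SF (gi X))].
  (* Naturality of [g] fails only by maps through projectives, which [F] sends into [N]. *)
  have H : @heq (quocat N) _ _
      (@ccomp (quocat N) _ _ _ (fmap F (g Y)) (fmap F (cosyz_map T f)))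
      (@ccomp (quocat N) _ _ _ (fmap F (hull_cokm K f)) (fmap F (g X))).
    apply: (inI_heq _ (FN (gn X Y f))); rewrite fmapB !fmapM; exact: hrefl.
  rewrite -ccompA; apply: htrans (ccomp_heq (hrefl _) H) _.
  by rewrite !ccompA; apply: ccomp_heq; [exact: sK_nat|exact: hrefl].
move=> X Y Z u v q [vq [k [ki qk]]]; have [h hi gp] := gP X.
have [C [v' [q' [k' [vq' ki' qk' dC]]]]] := cone_ex u.
have po := pushoutP (fr_conf T X) vq ki qk.
have po' := pushoutP (hull_ip K X) vq' ki' qk'.
have [c [ic cv qc]] := pushout_map_iso T (fr_conf T X) po vq qk (@fr_injP _ T X)
  (hull_ip K X) po' vq' qk' (@hull_inj _ _ _ K X) hi gp.
apply: dsI dC; exists (idm (F X)), (idm (F Y)), (fmap F c); split; split.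
- exact: (@is_iso_id (quocat N)).
- exact: (@is_iso_id (quocat N)).
- exact: (is_iso_fmap SF ic).
- exact: htrans (ccomp1m _) (hsym (ccompm1 _)).
- apply: htrans (hsym (ccompm1 _)); apply: quot_of_heq.
  by apply: htrans (hsym (fmapM F c v)) _; exact: fmap_heq cv.
- have H : @heq (quocat N) _ _
      (@ccomp (quocat N) _ _ _ (fmap F (g X)) (fmap F q))
      (@ccomp (quocat N) _ _ _ (fmap F q') (fmap F c)).
    apply: quot_of_heq; apply: htrans (hsym (fmapM F _ _)) (htrans _ (fmapM F _ _)).
    exact: fmap_heq (hsym qc).
  apply: htrans (ccomp_heq (fmap1 Sh (F X)) (hrefl _)) _.
  apply: htrans (ccomp1m _) _; rewrite -!ccompA; exact: ccomp_heq (hrefl _) H.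
Qed.
End StableToQuotient.

(** * Homotopies between monomorphisms and factorizations through projectives *)

Section Homotopy.
Local Open Scope cat_scope.
Variables (S : comNzRingType) (w : S) (X : lmodType S -> Prop).
Hypothesis w_reg : nonzerodivisor w.
Hypothesis X_proj : forall M, fg_proj M -> X M.
Hypothesis X_fg : forall M, X M -> fin_gen M.
Hypothesis X_ext : forall (A B C P : lmodType S) (f : {linear A -> B})
  (g : {linear B -> C}), X C -> fg_proj P -> short_exact f g ->
  forall u : {linear A -> P}, exists v : {linear B -> P}, forall x, v (f x) = u x.

(* With [s] and [t] read as a homotopy, this is null-homotopy of the induced map
   of pairs (ar, back); it amounts to factoring through (E0 Z = E0 Z) + (E0 W -w-> E0 W). *)
Definition mon_homotopic (Z W : Mon w X) (f : arrow Z W) :=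
  exists (s : {linear E0 Z -> E1 W}) (t : {linear E1 Z -> E0 W}),
    (forall x, hom1 f x = s (ar Z x) + back W (t x))%R /\
    (forall y, hom0 f y = ar W (s y) + t (back Z y))%R.

Lemma mon_tgt_proj (Z : Mon w X) : fg_proj (E0 Z).
Proof. by case: (svalP Z). Qed.

(** The homotopy supplies the factorization: [a] has components identity and [t], [b] has components
    [s] and identity, and [b ∘ a] spells out the two homotopy equations. *)
Lemma mon_homotopic_factor (Z W : Mon w X) (f : arrow Z W) :
  mon_homotopic f -> exists (P : Mon w X) (b : arrow P W) (a : arrow Z P),
    [/\ projective_obj P, injective_obj P & f ≈ b ∘ a].
Proof.
move=> [s [t [f1 f0]]].
pose P := J w_reg X_proj X_fg (mon_tgt_proj Z) (mon_tgt_proj W).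
have [a [a1 a0]] := J_in w_reg X_proj X_fg (mon_tgt_proj Z) (mon_tgt_proj W) idfun t.
have [b [b1 b0]] := J_out w_reg X_proj X_fg (mon_tgt_proj Z) (mon_tgt_proj W) s idfun.
exists P, b, a; split; [exact: J_proj|exact: J_inj|].
by split=> x; rewrite /= ?a1 ?a0 ?b1 ?b0 ?f1 ?f0.
Qed.

Lemma mon_homotopic_thru_proj (Z W : Mon w X) (f : arrow Z W) :
  mon_homotopic f -> thru_proj f.
Proof. by move=> /mon_homotopic_factor[P [b [a [pP _ e]]]]; exists P, b, a. Qed.

(** Such a [Z] is a retract of an injective object. Contractibility is visibly kept by the inclusion
    into [MonG], so this is how injectivity is carried over. *)
Lemma mon_contractible_injective (Z : Mon w X) :
  mon_homotopic (idm Z) -> injective_obj Z.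
Proof.
move=> /mon_homotopic_factor[P [b [a [_ iP e]]]] U V W i p cf t.
have [s Hs] := iP _ _ _ _ _ cf (a ∘ t).
by exists (b ∘ s); rewrite -ccompA Hs ccompA -e ccomp1m; exact: hrefl.
Qed.
End Homotopy.

(** * Monomorphisms of projectives as matrix factorizations, and their explicit hulls *)

Section Factorizations.
Local Open Scope cat_scope.
Variables (S : comNzRingType) (w : S).
Hypothesis w_reg : nonzerodivisor w.

Lemma mon_src_proj (Z : MonP w) : fg_proj (E1 Z).
Proof. by case: (svalP Z). Qed.

Definition mon_mf (Z : MonP w) : mf w :=
  MF (mon_src_proj Z) (mon_tgt_proj Z) (@backP' S w _ Z) (@backP S w _ Z).

Definition mon_mf_hom (Z W : MonP w) (f : arrow Z W) :
  mf_hom (mon_mf Z) (mon_mf W) :=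
  @MFHom S w (mon_mf Z) (mon_mf W) (hom1 f) (hom0 f) (back_nat f)
    (fun x => esym (ar_nat f x)).

Lemma rho1_inj (M : mf w) : injective (rho1 M).
Proof.
move=> x y e; apply/eqP; rewrite -subr_eq0; apply/eqP.
by apply: (fg_proj_reg w_reg (mf1_proj M)); rewrite -rho01 linearB e subrr linear0.
Qed.

Lemma fg_proj_fg (M : lmodType S) : fg_proj M -> fin_gen M.
Proof. by case. Qed.

Definition mf_mon (M : mf w) : MonP w :=
  mkmon fg_proj_fg (mf1_proj M) (mf0_proj M) (@rho1_inj M)
    (fun y => ex_intro _ (rho0 M y) (rho10 y)).

Definition mf_mon_hom (M N : mf w) (f : mf_hom M N) : arrow (mf_mon M) (mf_mon N) :=
  @MorHom S (sval (mf_mon M)) (sval (mf_mon N)) (psi1 f) (psi0 f)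
    (fun x => esym (psi_rho1 f x)).

(** [back] comes from a choice, but injectivity of the structure map leaves only one candidate. *)
Lemma back_mf_mon (M : mf w) y : back (mf_mon M) y = rho0 M y.
Proof. by apply: ar_inj; rewrite backP; exact: esym (rho10 y). Qed.

Lemma null_homotopic_mon_homotopic (M N : mf w) (f : mf_hom M N) :
  null_homotopic f -> mon_homotopic (mf_mon_hom f).
Proof.
move=> [s [t [f0 f1]]]; exists s, t.
by split=> x; rewrite back_mf_mon; [exact: f1|exact: f0].
Qed.

Lemma mon_homotopic_null_homotopic (Z W : MonP w) (f : arrow Z W) :
  mon_homotopic f -> null_homotopic (mon_mf_hom f).
Proof. by move=> [s [t [f1 f0]]]; exists s, t. Qed.

Section Hull.
Variable Z : MonP w.

Definition hull : MonP w :=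
  J w_reg (fun _ pM => pM) fg_proj_fg (mon_tgt_proj Z) (mon_src_proj Z).

(** The cokernel of the hull: its structure map is [- back Z], from [E0 Z] to [E1 Z]. *)
Definition hull_shift : MonP w := mf_mon (mf_shift (mon_mf Z)).

Lemma hull_in_comm (x : src (sval Z)) :
  lpair idfun (back Z) (arr (sval Z) x) = arr (sval hull) (lpair (ar Z) idfun x).
Proof. by rewrite /= backP'. Qed.
Definition hull_in : arrow Z hull := @MorHom S (sval Z) (sval hull) _ _ hull_in_comm.

(** Taking [fst] minus and [snd] minus in the two degrees produces the sign in the shift of [DB]. *)
Definition hull_out1 : {linear (E0 Z * E1 Z)%type -> E0 Z} := fst \- (ar Z \o snd).
Definition hull_out0 : {linear (E0 Z * E1 Z)%type -> E1 Z} := snd \- (back Z \o fst).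
Lemma hull_out_comm (x : src (sval hull)) :
  hull_out0 (arr (sval hull) x) = arr (sval hull_shift) (hull_out1 x).
Proof.
case: x => a b; rewrite /= linearB [back Z (arr (sval Z) _)]backP'.
by rewrite opprB.
Qed.
Definition hull_out : arrow hull hull_shift :=
  @MorHom S (sval hull) (sval hull_shift) _ _ hull_out_comm.

Lemma hull_conf : conf hull_in hull_out.
Proof.
split; split=> /=.
- by move=> x y [].
- by move=> z; exists (z, 0); rewrite /= linear0 subr0.
- move=> [a b]; split=> [/eqP|[x [<- <-]]]; last by rewrite /= subrr.
  by rewrite subr_eq0 /= => /eqP ->; exists b.
- by move=> x y [].
- by move=> z; exists (0, z); rewrite /= linear0 subr0.
- move=> [a b]; split=> [/eqP|[x [<- <-]]]; last by rewrite /= subrr.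
  by rewrite subr_eq0 /= => /eqP ->; exists a.
Qed.

Lemma hull_injective : injective_obj hull.
Proof. by apply: J_inj; exact: fgp_ext. Qed.

(** A map out of the hull is determined by its source component on the summand with identity
    structure map and its target component on the summand with structure map [w]. These restrictions
    are [s] and [t]. *)
Lemma hull_homotopic (W : MonP w) (g : arrow hull W) : mon_homotopic (g ∘ hull_in).
Proof.
pose s : {linear E0 Z -> E1 W} := hom1 g \o lpair idfun \0.
pose t : {linear E1 Z -> E0 W} := hom0 g \o lpair \0 idfun.
have e (x : E0 Z * E1 Z) : x = ((x.1, 0) + (0, x.2))%R.
  by case: x => a b; congr pair; rewrite /= ?addr0 ?add0r.
exists s, t; split=> x.
  rewrite /= [X in hom1 g X](e (_, x)) linearD; congr (_ + _)%R.
  (* On the second summand the structure map is [w], so [back] is the identity there. *)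
  have h : back hull (0, x)%R = (0, x).
    by apply: (@ar_inj S w _ hull); rewrite backP; congr pair; rewrite /= scaler0.
  exact: etrans (congr1 (hom1 g) (esym h)) (back_nat g _).
rewrite /= [X in hom0 g X](e (_, back Z x)) linearD; congr (_ + _)%R.
apply: etrans _ (ar_nat g _); congr (hom0 g _).
by congr pair; rewrite /= scaler0.
Qed.
End Hull.

(** Projectives are injective, so [a] extends to the hull of [Z] and [f] factors through that hull;
    [hull_homotopic] then applies. *)
Lemma thru_proj_mon_homotopic (T : frobenius (MonP w)) (Z W : MonP w)
    (f : arrow Z W) : thru_proj f -> mon_homotopic f.
Proof.
move=> [P [b [a [pP [f1 f0]]]]].
have [a' [e1 e0]] : exists a' : arrow (hull Z) P, a' ∘ hull_in Z ≈ a.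
  exact: (proj1 (fr_proj_inj T P) pP _ _ _ _ _ (hull_conf Z)).
have [s [t [h1 h0]]] := hull_homotopic (b ∘ a').
exists s, t; split=> x; [rewrite -h1|rewrite -h0] => /=.
  by rewrite [hom1 a' _]e1 f1.
by rewrite [hom0 a' _]e0 f0.
Qed.
End Factorizations.

(** * The equivalence with matrix factorizations up to homotopy *)

Section MatrixFactorizations.
Local Open Scope cat_scope.
Variables (S : comNzRingType) (w : S).
Hypothesis w_reg : nonzerodivisor w.

Definition pair_of_mon : functor (MonP w) (Pair w).
Proof.
by refine (@Functor (MonP w) (Pair w) (@mon_mf S w) (@mon_mf_hom S w) _ _ _ _).
Defined.

Definition mon_of_pair : functor (Pair w) (MonP w).
Proof.
by refine (@Functor (Pair w) (MonP w) (mf_mon w_reg) (mf_mon_hom w_reg) _ _ _ _).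
Defined.

Variable T : frobenius (MonP w).

Lemma pair_of_mon_thru_proj (Z W : MonP w) (f : arrow Z W) :
  thru_proj f -> null_homotopic (fmap pair_of_mon f).
Proof. by move=> /(thru_proj_mon_homotopic w_reg T); exact: mon_homotopic_null_homotopic. Qed.

Lemma mon_of_pair_null_homotopic (M N : Pair w) (f : arrow M N) :
  null_homotopic f -> thru_proj (fmap mon_of_pair f).
Proof.
move=> /(null_homotopic_mon_homotopic w_reg).
exact: (mon_homotopic_thru_proj w_reg (fun _ pM => pM) (@fg_proj_fg S) (@fgp_ext S)).
Qed.

Definition stable_mf : functor (stable T) (DB w) :=
  @quo_functor (MonP w) (Pair w) (thru_proj_ideal T) (null_homotopic_ideal w)
    pair_of_mon pair_of_mon_thru_proj.

Definition mf_stable : functor (DB w) (stable T) :=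
  @quo_functor (Pair w) (MonP w) (null_homotopic_ideal w) (thru_proj_ideal T)
    mon_of_pair mon_of_pair_null_homotopic.

(** A round trip keeps both modules and the map between them, so the comparison has identity
    components. *)
Definition mon_mfK (Z : MonP w) : arrow (mon_of_pair (pair_of_mon Z)) Z :=
  @MorHom S (sval (mf_mon w_reg (mon_mf Z))) (sval Z) idfun idfun (fun=> erefl).

Lemma mon_mfK_nat_iso :
  @nat_iso _ _ (fcomp mon_of_pair pair_of_mon) (fid (MonP w)) mon_mfK.
Proof.
split=> // Z; exists (@MorHom S (sval Z) (sval (mf_mon w_reg (mon_mf Z))) idfun idfun (fun=> erefl)).
by split.
Qed.

Lemma mf_monK_comm (M : mf w) x :
  idfun (rho0 (mon_mf (mf_mon w_reg M)) x) = rho0 M (idfun x).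
Proof. exact: back_mf_mon. Qed.
Definition mf_monK (M : Pair w) : arrow (pair_of_mon (mon_of_pair M)) M :=
  @MFHom S w (mon_mf (mf_mon w_reg M)) M idfun idfun (@mf_monK_comm M) (fun=> erefl).

Lemma mf_monKV_comm (M : mf w) x :
  idfun (rho0 M x) = rho0 (mon_mf (mf_mon w_reg M)) (idfun x).
Proof. by symmetry; exact: back_mf_mon. Qed.

Lemma mf_monK_nat_iso :
  @nat_iso _ _ (fcomp pair_of_mon mon_of_pair) (fid (Pair w)) mf_monK.
Proof.
split=> // M; exists (@MFHom S w M (mon_mf (mf_mon w_reg M)) idfun idfun (@mf_monKV_comm M) (fun=> erefl)).
by split.
Qed.

(** [pair_of_mon] and [mon_of_pair] are already quasi-inverse before passing to quotients, and each
    carries one ideal into the other. *)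
Lemma stable_mf_equivalence : @equivalence (stable T) (DB w) stable_mf.
Proof.
exists mf_stable; split.
  by exists mon_mfK; apply: quo_nat_iso_id; exact: mon_mfK_nat_iso.
by exists mf_monK; apply: quo_nat_iso_id; exact: mf_monK_nat_iso.
Qed.

Lemma DB_dist_iso (X Y Z X' Y' Z' : DB w)
    (u : arrow X Y) (v : arrow Y Z) (q : arrow Z (shift X))
    (u' : arrow X' Y') (v' : arrow Y' Z') (q' : arrow Z' (shift X')) :
  tri_iso u v q u' v' q' -> dist u' v' q' -> dist u v q.
Proof.
move=> H [X2 [Y2 [f K]]]; exists X2, Y2, f.
exact: tri_iso_trans H K.
Qed.
End MatrixFactorizations.

(** * Mapping cones as pushouts along the explicit hulls *)

Section ConeTriangles.
Local Open Scope cat_scope.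
Variables (S : comNzRingType) (w : S).
Hypothesis w_reg : nonzerodivisor w.

Section HullMap.
Variables (Y Z : MonP w) (f : arrow Y Z).
Definition hull_map_lin : {linear (E0 Y * E1 Y)%type -> (E0 Z * E1 Z)%type} :=
  lpair (hom0 f \o fst : {linear _ -> _}) (hom1 f \o snd : {linear _ -> _}).
Lemma hull_map_comm (x : src (sval (hull w_reg Y))) :
  hull_map_lin (arr (sval (hull w_reg Y)) x) = arr (sval (hull w_reg Z)) (hull_map_lin x).
Proof. by congr pair; rewrite /= linearZ. Qed.
Definition hull_map : arrow (hull w_reg Y) (hull w_reg Z) :=
  @MorHom S (sval (hull w_reg Y)) (sval (hull w_reg Z)) _ _ hull_map_comm.

Lemma hull_map_in : hull_map ∘ hull_in w_reg Y ≈ hull_in w_reg Z ∘ f.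
Proof. by split=> x; congr pair => /=; [exact: ar_nat|exact: back_nat]. Qed.

Lemma hull_map_out : mf_mon_hom w_reg (mf_shift_hom (mon_mf_hom f)) ∘ hull_out w_reg Y
  ≈ hull_out w_reg Z ∘ hull_map.
Proof.
split=> -[a b] /=; rewrite linearB; congr (_ - _)%R; first exact: ar_nat.
exact: back_nat.
Qed.
End HullMap.

Definition mon_hulls : hull_system (fid (MonP w)) :=
  @HullSystem (MonP w) (MonP w) (fid (MonP w)) (hull w_reg) (hull_shift w_reg)
    (hull_in w_reg) (hull_out w_reg) (hull_conf w_reg) (@hull_injective S w w_reg)
    (fun Y Z f => mf_mon_hom w_reg (mf_shift_hom (mon_mf_hom f)))
    (fun Y Z f => ex_intro _ (hull_map f) (conj (hull_map_in f) (hull_map_out f))).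

Section MonCone.
Variables (Y Z : MonP w) (u : arrow Y Z).

Definition mon_cone : MonP w := mf_mon w_reg (cone (mon_mf_hom u)).

Definition mon_cone_in : arrow Z mon_cone :=
  @MorHom S (sval Z) (sval mon_cone) _ _ (fun x => esym (psi_rho1 (cone_in (mon_mf_hom u)) x)).

Definition mon_cone_out : arrow mon_cone (hull_shift w_reg Y) :=
  mf_mon_hom w_reg (cone_out (mon_mf_hom u)).

(** The first entries here and in [hull_cone0] extend the components of [u] to the hull, and the
    second entries are [hull_out]. The extensions fail to commute with the structure maps by
    [hom0 u] applied to [hull_out1], which is the off-diagonal entry of the cone. *)
Definition hull_cone1 : {linear (E0 Y * E1 Y)%type -> (E1 Z * E0 Y)%type} :=
  lpair (hom1 u \o snd : {linear _ -> _}) (fst \- (ar Y \o snd)).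
Definition hull_cone0 : {linear (E0 Y * E1 Y)%type -> (E0 Z * E1 Y)%type} :=
  lpair (hom0 u \o fst : {linear _ -> _}) (snd \- (back Y \o fst)).
Lemma hull_cone_comm (x : src (sval (hull w_reg Y))) :
  hull_cone0 (arr (sval (hull w_reg Y)) x) = arr (sval mon_cone) (hull_cone1 x).
Proof.
case: x => a b; congr pair => /=.
  by rewrite linearB [hom0 u (ar Y b)]ar_nat addrC subrK.
by rewrite linearB [back Y (ar Y b)]backP' opprB.
Qed.
Definition hull_cone : arrow (hull w_reg Y) mon_cone :=
  @MorHom S (sval (hull w_reg Y)) (sval mon_cone) _ _ hull_cone_comm.

Lemma mon_cone_conf : conf mon_cone_in mon_cone_out.
Proof.
split; split=> /=.
- by move=> x y [].
- by move=> z; exists (0, z).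
- by move=> [a b]; split=> [/= ->|[x [_ <-]]] //; exists a.
- by move=> x y [].
- by move=> z; exists (0, z).
- by move=> [a b]; split=> [/= ->|[x [_ <-]]] //; exists a.
Qed.

Lemma hull_cone_in : hull_cone ∘ hull_in w_reg Y ≈ mon_cone_in ∘ u.
Proof. by split=> x; congr pair; rewrite /= subrr. Qed.

Lemma mon_cone_out_hull : mon_cone_out ∘ hull_cone ≈ hull_out w_reg Y.
Proof. by split. Qed.
End MonCone.
End ConeTriangles.

Section PushoutAlongMon.
Local Open Scope cat_scope.

(* The two components of [u] extend to maps [m1], [m0] on [I], because their targets
   are projective; so the pushout is Y + D with a twist [phi] of the structure map that
   measures the failure of [(m1, m0)] to be a morphism. *)
Lemma mon_pushout_ex (S : comNzRingType) (w : S) (X : lmodType S -> Prop)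
    (X_fg : forall M, X M -> fin_gen M)
    (X_prod : forall M N, X M -> X N -> X (M * N)%type)
    (X_ext : forall (A B C P : lmodType S) (f : {linear A -> B})
      (g : {linear B -> C}), X C -> fg_proj P -> short_exact f g ->
      forall u : {linear A -> P},
      exists v : {linear B -> P}, forall x, v (f x) = u x)
    (X_proj : forall M, fg_proj M -> X M)
    (A I D Y : Mon w X) (i : arrow A I) (p : arrow I D) (u : arrow A Y) :
  conf i p -> fg_proj (E1 Y) ->
  exists Z (v : arrow Y Z) (q : arrow Z D) (k : arrow I Z),
    [/\ conf v q, k ∘ i ≈ v ∘ u & q ∘ k ≈ p].
Proof.
move=> [ip1 ip0] pY1; have [_ ps1 _] := ip1; have [_ ps0 _] := ip0.
have [XD pD _ _] := svalP D; have [XY pY _ _] := svalP Y.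
have [m1 Hm1] := X_ext _ _ _ _ _ _ XD pY1 ip1 (hom1 u).
have [m0 Hm0] := X_ext _ _ _ _ _ _ (X_proj _ pD) pY ip0 (hom0 u).
(* The defect of [(m1, m0)] vanishes on [A] because [u] is a morphism, so it descends to [E1 D]. *)
have [|phi Hphi] := short_exact_coker (t := (ar Y \o m1) \- (m0 \o ar I)) ip1.
  move=> x; rewrite /= Hm1.
  have -> : ar I (hom1 i x) = hom0 i (ar A x) by symmetry; exact: ar_nat.
  by rewrite Hm0 -[ar Y _]ar_nat subrr.
pose f : {linear (E1 Y * E1 D)%type -> (E0 Y * E0 D)%type} :=
  lpair ((ar Y \o fst) \- (phi \o snd)) (ar D \o snd : {linear _ -> _}).
have fE y d : f (y, d) = (ar Y y - phi d, ar D d)%R by [].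
have fi : injective f.
  move=> [y d] [y' d']; rewrite !fE => -[e /ar_inj dd']; subst d'.
  by move/addIr/ar_inj: e => ->.
have fw z : exists x, f x = (w *: z)%R.
  case: z => y d; have [x Hx] := ps0 d.
  (* With [x] over [d], the pair [(y, d)] is the sum of [(y - m0 x, 0)] from [Y] and [(m0 x, d)]
     from [I]; the witness adds the images of [back] of [y - m0 x] and of [x]. *)
  exists (back Y (y - m0 x) + m1 (back I x), back D d)%R.
  rewrite fE linearD !backP; congr pair => /=.
  have -> : back D d = hom1 p (back I x) by rewrite -Hx; symmetry; exact: back_nat.
  by rewrite Hphi /= backP linearZ /= scalerBr -addrA subKr subrK.
pose Z : Mon w X := mkmon X_fg (X_prod _ _ XY XD) (fg_proj_prod pY pD) fi fw.
have cv (y : src (sval Y)) : (lpair idfun \0 : {linear E0 Y -> (E0 Y * E0 D)%type}) (arr (sval Y) y)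
    = arr (sval Z) ((lpair idfun \0 : {linear E1 Y -> (E1 Y * E1 D)%type}) y).
  by rewrite [RHS]fE !linear0 addr0.
have cq (z : src (sval Z)) : (snd : {linear (E0 Y * E0 D)%type -> E0 D}) (arr (sval Z) z)
    = arr (sval D) ((snd : {linear (E1 Y * E1 D)%type -> E1 D}) z) by [].
have ck (x : src (sval I)) : lpair m0 (hom0 p) (arr (sval I) x)
    = arr (sval Z) (lpair m1 (hom1 p) x).
  rewrite [RHS]fE Hphi /= subKr; congr pair; exact: ar_nat.
exists Z, (@MorHom S (sval Y) (sval Z) _ _ cv), (@MorHom S (sval Z) (sval D) _ _ cq),
  (@MorHom S (sval I) (sval Z) _ _ ck).
split; split=> //.
- split=> /=.
  + by move=> x y [].
  + by move=> z; exists (0, z).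
  + by move=> [a b]; split=> [/= ->|[x [_ <-]]] //; exists a.
- split=> /=.
  + by move=> x y [].
  + by move=> z; exists (0, z).
  + by move=> [a b]; split=> [/= ->|[x [_ <-]]] //; exists a.
- have [_ _ pe] := ip1; move=> x; congr pair; first exact: Hm1.
  by apply/pe; exists x.
- have [_ _ pe] := ip0; move=> x; congr pair; first exact: Hm0.
  by apply/pe; exists x.
Qed.
End PushoutAlongMon.

(** * Standard triangles go to mapping cone triangles *)

Section MatrixFactorizationTriangles.
Local Open Scope cat_scope.
Variables (S : comNzRingType) (w : S).
Hypothesis w_reg : nonzerodivisor w.
Variable T : frobenius (MonP w).

Lemma mf_monK_iso (M : Pair w) : @is_iso (DBcat w) _ _ (mf_monK w_reg M).
Proof.
exact (quo_is_iso (null_homotopic_ideal w) (proj1 (mf_monK_nat_iso w_reg) M)).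
Qed.

Lemma mf_monK_shift_nat (Y Z : MonP w) (f : arrow Y Z) :
  @heq (DBcat w) (mon_mf (hull_shift w_reg Y)) (mf_shift (mon_mf Z))
    (mf_comp (mf_monK w_reg (mf_shift (mon_mf Z)))
      (mon_mf_hom (mf_mon_hom w_reg (mf_shift_hom (mon_mf_hom f)))))
    (mf_comp (mf_shift_hom (mon_mf_hom f)) (mf_monK w_reg (mf_shift (mon_mf Y)))).
Proof. by apply: quot_of_heq; split. Qed.

(** [mon_cone] becomes the mapping cone after a round trip through monomorphisms, so [mf_monK] on
    the third term gives the isomorphism of triangles. *)
Lemma mon_cone_dist (X Y : MonP w) (u : arrow X Y) :
  @DB_dist S w (mon_mf X) (mon_mf Y) (mon_mf (mon_cone w_reg u))
    (mon_mf_hom u) (mon_mf_hom (mon_cone_in w_reg u))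
    (mf_comp (mf_monK w_reg (mf_shift (mon_mf X))) (mon_mf_hom (mon_cone_out w_reg u))).
Proof.
exists (mon_mf X), (mon_mf Y), (mon_mf_hom u), (mf_id _), (mf_id _), (mf_monK w_reg _).
split; split; try by apply: quot_of_heq; split.
- exact: (@is_iso_id (DBcat w)).
- exact: (@is_iso_id (DBcat w)).
- exact: mf_monK_iso.
Qed.

Lemma stable_mf_triangle :
  exists theta : forall X : stable T,
      arrow (stable_mf w_reg T (shift X)) (shift (stable_mf w_reg T X)),
    @triangle_functor (stable T) (DB w) (stable_mf w_reg T) theta.
Proof.
apply: (@stable_to_quotient_triangle (MonP w) T (Pair w) (null_homotopic_ideal w)
  (pair_of_mon w) (@pair_of_mon_thru_proj S w w_reg T) (DB_shift w) (@DB_dist S w)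
  (@DB_dist_iso S w) (mon_hulls w_reg) (fun X => mf_monK w_reg (mf_shift (mon_mf X)))
  (fun X => mf_monK_iso (mf_shift (mon_mf X))) mf_monK_shift_nat (@mon_pushout S w _)).
move=> X Y u; exists (mon_cone w_reg u), (mon_cone_in w_reg u), (mon_cone_out w_reg u),
  (hull_cone w_reg u).
split; [exact: mon_cone_conf|exact: hull_cone_in|exact: mon_cone_out_hull|exact: mon_cone_dist].
Qed.
End MatrixFactorizationTriangles.

(** * The inclusion of [MonP] into [MonG] *)

Section InclusionOfProjectives.
Local Open Scope cat_scope.
Variables (S : comNzRingType) (w : S).
Hypothesis w_reg : nonzerodivisor w.
Variables (TP : frobenius (MonP w)) (TG : frobenius (MonG w)).
Local Notation incl := (Mon_inclusion w).

(** The two sides are separate choices, made for objects of different categories; they agree after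
    the injective [ar]. *)
Lemma back_incl (Z : MonP w) y : back (incl Z) y = back Z y.
Proof. by apply: ar_inj; rewrite backP; symmetry; exact: (@backP S w _ Z). Qed.

Lemma mon_homotopic_incl (Y Z : MonP w) (f : arrow Y Z) :
  mon_homotopic f -> mon_homotopic (fmap incl f).
Proof.
move=> [s [t [f1 f0]]]; exists s, t.
by split=> x; rewrite back_incl; [exact: f1|exact: f0].
Qed.

(** The identity of [I] factors through the projective [I] itself, hence is homotopic to zero; the
    homotopy persists in [MonG], where contractible objects are injective. *)
Lemma incl_injective (I : MonP w) : injective_obj I -> injective_obj (incl I).
Proof.
move=> iI; apply: (mon_contractible_injective w_reg (@fg_proj_gor_proj S) (@gp_fg S) (@gp_ext S)).
apply: (@mon_homotopic_incl I I (idm I)); apply: (thru_proj_mon_homotopic w_reg TP).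
exists I, (idm I), (idm I); split; first exact/(fr_proj_inj TP).
by rewrite ccomp1m; exact: hrefl.
Qed.

Lemma incl_fully_faithful : fully_faithful incl.
Proof. by split=> [Y Z f g|Y Z h] //; exists h; exact: hrefl. Qed.

Lemma incl_conf (X Y Z : MonP w) (i : arrow X Y) (p : arrow Y Z) :
  conf i p -> conf (fmap incl i) (fmap incl p).
Proof. exact id. Qed.

Lemma incl_triangle :
  exists (H : stably_defined TP TG incl)
         (theta : forall X : stable TP,
            arrow (stable_functor H (shift X)) (shift (stable_functor H X))),
    triangle_functor theta /\ fully_faithful (stable_functor H).
Proof.
apply: (@exact_stable_triangle (MonP w) (MonG w) TP TG incl incl_fully_faithful
  incl_conf incl_injective (@mon_pushout S w _)).
move=> Y A I D i p u ip.
exact: (mon_pushout_ex (@gp_fg S) (@gp_prod S) (@gp_ext S) (@fg_proj_gor_proj S) u ip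
  (mon_src_proj Y)).
Qed.
End InclusionOfProjectives.

Theorem theorem1p1 (S : comNzRingType) (n : S -> Prop) (w : S)
    (S_noeth : noetherian S) (S_local : local_ring n)
    (w_in : n w) (w_reg : nonzerodivisor w)
    (TP : frobenius (MonP w)) (TG : frobenius (MonG w)) :
  (exists (H : stably_defined TP TG (Mon_inclusion w))
          (theta : forall X : stable TP,
             arrow (stable_functor H (shift X)) (shift (stable_functor H X))),
     triangle_functor theta /\ fully_faithful (stable_functor H)) /\
  (exists (F : functor (stable TP) (DB w))
          (theta : forall X : stable TP, arrow (F (shift X)) (shift (F X))),
     triangle_functor theta /\ equivalence F).
Proof.
split; first exact: incl_triangle.
exists (stable_mf w_reg TP); have [theta Htheta] := stable_mf_triangle w_reg TP.
by exists theta; split; [exact: Htheta|exact: stable_mf_equivalence].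
Qed.
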